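(* Let $1\leq h\leq p-1$, let $\chi:\mathbf{Q}_p^\times\to E^\times$ be a smooth character and $\sigma=\chi\omega^{h-1}\otimes\chi$. Then there is an isomorphism of representations of $\mathrm{B}$ \[\Pi_2(h,\sigma)\simeq\frac{\operatorname{ind}_{\operatorname{GL}_2(\mathbf{Z}_p)\mathrm{Z}}^{\operatorname{GL}_2(\mathbf{Q}_p)}\operatorname{Sym}^{h-1}E^2}{T\left(\operatorname{ind}_{\operatorname{GL}_2(\mathbf{Z}_p)\mathrm{Z}}^{\operatorname{GL}_2(\mathbf{Q}_p)}\operatorname{Sym}^{h-1}E^2\right)}\otimes(\chi\circ\det),\] the right-hand side being viewed as a representation of $\mathrm{B}$ by restriction.
   Context: $p$ is a prime, $E$ a finite extension of $\mathbf{F}_p$, $\mathrm{B}$ the invertible upper triangular matrices in $\operatorname{GL}_2(\mathbf{Q}_p)$, $\mathrm{K}=\mathrm{B}\cap\operatorname{GL}_2(\mathbf{Z}_p)$, $\mathrm{Z}$ the center (scalar matrices). $\omega:\mathbf{Q}_p^\times\to\mathbf{F}_p^\times$ is $p^mu\mapsto u\bmod p$ ($u\in\mathbf{Z}_p^\times$). For $\sigma=\sigma_1\otimes\sigma_2$ (character $\begin{pmatrix}a&b\\0&d\end{pmatrix}\mapsto\sigma_1(a)\sigma_2(d)$ of $\mathrm{K}\mathrm{Z}$), $\operatorname{ind}_{\mathrm{K}\mathrm{Z}}^{\mathrm{B}}\sigma$ is the space of $f:\mathrm{B}\to E$ with $f(kg)=\sigma(k)f(g)$ for $k\in\mathrm{K}\mathrm{Z}$,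 compactly supported modulo $\mathrm{Z}$, with $(gf)(h)=f(hg)$; $[g](h)=\sigma(hg)$ if $h\in\mathrm{K}\mathrm{Z}g^{-1}$ and $0$ otherwise. $w_{\ell,2}=\sum_{j=0}^{p^2-1}\binom{j}{\ell}\left[\begin{pmatrix}1&-jp^{-2}\\0&1\end{pmatrix}\right]$ (binomials in $\mathbf{F}_p$). With $\lambda=\sigma_1(p)=\sigma_2(p)$, $S_2(h,\sigma)$ is the span of the $\mathrm{B}$-translates of $\lambda^{-2}\left[\begin{pmatrix}1&0\\0&p^2\end{pmatrix}\right]+w_{h(p-1),2}$, and $\Pi_2(h,\sigma)=\operatorname{ind}_{\mathrm{K}\mathrm{Z}}^{\mathrm{B}}\sigma/S_2(h,\sigma)$. $\operatorname{Sym}^rE^2$ is the space of homogeneous polynomials of degree $r$ in $x,y$ over $E$, with $\begin{pmatrix}a&b\\c&d\end{pmatrix}\in\operatorname{GL}_2(\mathbf{Z}_p)$ acting by $P(x,y)\mapsto P(ax+cy,bx+dy)$ (via reduction mod $p$) and $\begin{pmatrix}p&0\\0&p\end{pmatrix}$ acting trivially. In the compact induction $\operatorname{ind}_{\operatorname{GL}_2(\mathbf{Z}_p)\mathrm{Z}}^{\operatorname{GL}_2(\mathbf{Q}_p)}\operatorname{Sym}^rE^2$, $[g,v]$ is the function $h\mapsto\operatorname{Sym}^r(hg)(v)$ if $hg\in\operatorname{GL}_2(\mathbf{Z}_p)\mathrm{Z}$ and $0$ otherwise, so $h[g,v]=[hg,v]$ and $[gk,v]=[g,kv]$. $T$ is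 the $\operatorname{GL}_2(\mathbf{Q}_p)$-equivariant Hecke operator (of Barthel–Livné) given for $0\le i\le r$ by $T([1,x^{r-i}y^i])=\sum_{j=0}^{p-1}\begin{pmatrix}p&j\\0&1\end{pmatrix}[1,(-j)^ix^r]+\delta_{i,r}\begin{pmatrix}1&0\\0&p\end{pmatrix}[1,y^r]$ (with $0^0=1$). *)

(* Defs.v *)
From HB Require Import structures.
From mathcomp Require Import all_boot all_order all_algebra all_field.
From mathcomp Require Import all_classical topology.
From mathcomp Require Import -(notations) mpoly.

(* multinomials is imported without its notations, which clash with those of
   mathcomp-analysis. *)

Set Implicit Arguments.
Unset Strict Implicit.
Unset Printing Implicit Defensive.
Import Order.TTheory GRing.Theory Num.Theory.
Local Open Scope ring_scope.

(* Z_p is the limit of the Z/p^n: x is given by its remainders modulo p^n. *)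
Record padic_int (p : nat) (p_pr : prime p) := PadicInt {
  prem :> nat -> nat;
  premP : forall n, (prem n.+1 %% p ^ n = prem n)%N }.

Section PadicInt.
Variables (p : nat) (p_pr : prime p).
Local Notation padic_int := (padic_int p_pr).
Local Notation PadicInt := (PadicInt p_pr).

HB.instance Definition _ := gen_eqMixin padic_int.
HB.instance Definition _ := gen_choiceMixin padic_int.

Lemma padic_eq (x y : padic_int) : (forall n, x n = y n) -> x = y.
Proof.
case: x y => [x xP] [y yP] /= /funext xy.
by case: _ / xy yP => yP; rewrite (Prop_irrelevance xP yP).
Qed.

Let pn_gt0 n : (0 < p ^ n)%N.
Proof. by rewrite expn_gt0 prime_gt0. Qed.

Lemma prem_mod (x : padic_int) n : (x n %% p ^ n = x n)%N.
Proof. by rewrite -[X in (X %% _)%N]premP modn_mod premP. Qed.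

Lemma prem_modle (x : padic_int) m n : (m <= n)%N -> (x n %% p ^ m = x m)%N.
Proof.
move=> /subnKC <-; elim: (n - m)%N => [|k IHk]; first by rewrite addn0 prem_mod.
by rewrite addnS -IHk -(premP x (m + k)%N) modn_dvdm // dvdn_exp2l ?leq_addr.
Qed.

Lemma prem_nat_subproof (k n : nat) : (k %% p ^ n.+1 %% p ^ n = k %% p ^ n)%N.
Proof. by rewrite modn_dvdm // dvdn_exp2l. Qed.
Definition padic_nat k := PadicInt (prem_nat_subproof k).

Let mod_pS k n : (k %% p ^ n.+1 = k %[mod p ^ n])%N.
Proof. exact: prem_nat_subproof. Qed.

Let add_subproof (x y : padic_int) n :
  ((x n.+1 + y n.+1) %% p ^ n.+1 %% p ^ n = (x n + y n) %% p ^ n)%N.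
Proof. by rewrite mod_pS -modnDm !premP. Qed.
Definition padic_add x y := PadicInt (add_subproof x y).

Let opp_subproof (x : padic_int) n :
  ((p ^ n.+1 - x n.+1) %% p ^ n.+1 %% p ^ n = (p ^ n - x n) %% p ^ n)%N.
Proof.
rewrite mod_pS; apply/eqP; rewrite -(eqn_modDr (x n)) subnK; last first.
  by rewrite -prem_mod ltnW // ltn_pmod.
rewrite modnn -(premP x n) modnDmr subnK ?expnS ?modnMl//.
by rewrite -expnS -prem_mod ltnW // ltn_pmod.
Qed.
Definition padic_opp x := PadicInt (opp_subproof x).

Let mul_subproof (x y : padic_int) n :
  ((x n.+1 * y n.+1) %% p ^ n.+1 %% p ^ n = (x n * y n) %% p ^ n)%N.
Proof. by rewrite mod_pS -modnMm !premP. Qed.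
Definition padic_mul x y := PadicInt (mul_subproof x y).

Let addA : associative padic_add.
Proof. by move=> x y z; apply: padic_eq => n /=; rewrite modnDmr modnDml addnA. Qed.
Let addC : commutative padic_add.
Proof. by move=> x y; apply: padic_eq => n /=; rewrite addnC. Qed.
Let add0 : left_id (padic_nat 0) padic_add.
Proof. by move=> x; apply: padic_eq => n /=; rewrite mod0n add0n prem_mod. Qed.
Let addN : left_inverse (padic_nat 0) padic_opp padic_add.
Proof.
move=> x; apply: padic_eq => n /=; rewrite modnDml subnK ?modnn ?mod0n//.
by rewrite -prem_mod ltnW // ltn_pmod.
Qed.
HB.instance Definition _ := GRing.isZmodule.Build padic_int addA addC add0 addN.

Let mulA : associative padic_mul.
Proof. by move=> x y z; apply: padic_eq => n /=; rewrite modnMmr modnMml mulnA. Qed.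
Let mulC : commutative padic_mul.
Proof. by move=> x y; apply: padic_eq => n /=; rewrite mulnC. Qed.
Let mul1 : left_id (padic_nat 1) padic_mul.
Proof. by move=> x; apply: padic_eq => n /=; rewrite modnMml mul1n prem_mod. Qed.
Let mulD : left_distributive padic_mul padic_add.
Proof. by move=> x y z; apply: padic_eq => n /=; rewrite modnMml modnDm mulnDl. Qed.
Let one_neq0 : padic_nat 1 != 0.
Proof.
apply/eqP => /(congr1 (fun x : padic_int => x 1%N)) /=.
by rewrite expn1 mod0n modn_small ?prime_gt1.
Qed.
HB.instance Definition _ :=
  GRing.Zmodule_isComNzRing.Build padic_int mulA mulC mul1 mulD one_neq0.

Definition padic_unit : pred padic_int := fun x => `[< exists y, y * x = 1 >].
Definition padic_inv (x : padic_int) := xget x [set y | y * x = 1]%classic.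

Let mulV : {in padic_unit, left_inverse 1 padic_inv *%R}.
Proof. by move=> x /asboolP[y yx]; rewrite /padic_inv; case: xgetP => // /(_ y). Qed.
Let unitP (x y : padic_int) : y * x = 1 -> padic_unit x.
Proof. by move=> yx; apply/asboolP; exists y. Qed.
Let inv_out : {in [predC padic_unit], padic_inv =1 id}.
Proof.
move=> x /asboolPn nx; rewrite /padic_inv; case: xgetP => // y _ yx.
by case: nx; exists y.
Qed.
HB.instance Definition _ :=
  GRing.ComNzRing_hasMulInverse.Build padic_int mulV unitP inv_out.

Let logn_prem (x : padic_int) m n : (m <= n)%N -> x m <> 0%N -> 
  (x n > 0)%N && (logn p (x n) < m)%N.
Proof.
move=> mn xm; have xn : (0 < x n)%N.
  by rewrite lt0n; apply/eqP => xn; apply: xm; rewrite -(prem_modle x mn) xn mod0n.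
rewrite xn ltnNge -pfactor_dvdn // /dvdn prem_modle //; exact/eqP.
Qed.

Let integral (x y : padic_int) : x * y = 0 -> (x == 0) || (y == 0).
Proof.
have nz (z : padic_int) : z != 0 -> exists n, z n <> 0%N.
  move=> z0; apply: contrapT => nz; move/eqP: z0; apply; apply: padic_eq => n.
  by rewrite /= mod0n; apply: contrapT => zn; apply: nz; exists n.
move=> xy; case: eqVneq => //= /nz[m xm]; case: eqVneq => //= /nz[n yn].
have /andP[x0 lx] := logn_prem (leq_addr n m) xm.
have /andP[y0 ly] := logn_prem (leq_addl m n) yn.
have /eqP := congr1 (fun z : padic_int => z (m + n)%N) xy; rewrite /= mod0n.
rewrite -/(dvdn _ _) pfactor_dvdn ?muln_gt0 ?x0// lognM // leqNgt.
by rewrite -addnS leq_add // ltnW.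
Qed.
HB.instance Definition _ := GRing.ComUnitRing_isIntegral.Build padic_int integral.

Definition padic_res (x : padic_int) : 'F_p := (x 1%N)%:R.

Let natF (n : nat) : (n %% p)%:R = n%:R :> 'F_p.
Proof. by rewrite {2}(divn_eq n p) natrD natrM pchar_Fp_0 // mulr0 add0r. Qed.

Lemma padic_res_zmod : zmod_morphism padic_res.
Proof.
have resD x y : padic_res (x + y) = padic_res x + padic_res y.
  by rewrite /padic_res /= expn1 natF natrD.
by move=> x y; apply/eqP; rewrite eq_sym subr_eq -resD subrK.
Qed.
Lemma padic_res_monoid : monoid_morphism padic_res.
Proof.
split; first by rewrite /padic_res /= expn1 natF.
by move=> x y; rewrite /padic_res /= expn1 natF natrM.
Qed.
HB.instance Definition _ :=
  GRing.isZmodMorphism.Build padic_int 'F_p padic_res padic_res_zmod.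
HB.instance Definition _ :=
  GRing.isMonoidMorphism.Build padic_int 'F_p padic_res padic_res_monoid.

Definition padic := {fraction padic_int}.
HB.instance Definition _ := GRing.Field.on padic.

Definition padic_of_int : padic_int -> padic := @FracField.tofrac padic_int.
HB.instance Definition _ := GRing.RMorphism.on padic_of_int.
End PadicInt.

Section PadicTopology.
Variables (p : nat) (p_pr : prime p).
Local Notation Zp := (padic_int p_pr).
Local Notation Qp := (padic p_pr).
Implicit Types (x y z : Zp).

Lemma prem_p n m : (p%:R ^+ n : Zp) m = (p ^ n %% p ^ m)%N.
Proof.
have premn k : (k%:R : Zp) m = (k %% p ^ m)%N.
  elim: k => [|k IHk]; first by [].
  by rewrite -addn1 natrD /= IHk modnDm.
by rewrite -natrX premn.
Qed.

Lemma padic_dvd n x : x n = 0%N -> exists z, x = p%:R ^+ n * z.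
Proof.
move=> xn0; have dv m : (p ^ n %| x (m + n)%N)%N.
  by rewrite /dvdn prem_modle ?leq_addl // xn0.
have pn0 m : (0 < p ^ m)%N by rewrite expn_gt0 prime_gt0.
have zP m : (x (m.+1 + n)%N %/ p ^ n %% p ^ m = x (m + n)%N %/ p ^ n)%N.
  rewrite -(premP x (m + n)%N) -addSn [in RHS]expnD.
  by rewrite [X in _ = (X %% _ %/ _)%N](esym (divnK (dv m.+1))) -muln_modl mulnK.
exists (PadicInt p_pr zP); apply: padic_eq => m.
rewrite [LHS](_ : _ = (p ^ n * (x (m + n)%N %/ p ^ n)) %% p ^ m)%N.
  by rewrite /= prem_p modnMml.
by rewrite mulnC divnK // prem_modle ?leq_addr.
Qed.

Lemma padic_int_natP n x y :
  x n = y n <-> exists z, y = x + p%:R ^+ n * z.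
Proof.
split=> [xy|[z ->]].
  have [z /eqP zP] : exists z, y - x = p%:R ^+ n * z.
    apply: padic_dvd; rewrite /= xy modnDmr subnKC ?modnn //.
    by rewrite -(prem_mod y) ltnW // ltn_pmod // expn_gt0 prime_gt0.
  by exists z; apply/eqP; rewrite addrC -subr_eq.
by rewrite /= prem_p modnn mul0n mod0n addn0 prem_mod.
Qed.

Lemma padic_unitP x : reflect (x 1%N <> 0%N) (x \is a GRing.unit).
Proof.
apply: (iffP idP) => [xu x1|x1].
  have [z xz] := padic_dvd x1; rewrite expr1 in xz.
  have /(congr1 (fun y : Zp => y 1%N)) : x * x^-1 = 1 by rewrite divrr.
  rewrite /= x1 mul0n mod0n expn1 modn_small ?prime_gt1 //.
have cop n : coprime (x n) (p ^ n).
  case: n => [|n]; first by rewrite expn0 coprimen1.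
  rewrite coprimeXr // coprime_sym prime_coprime //; apply/negP.
  have := prem_modle x (ltn0Sn n); rewrite /dvdn expn1 => ->.
  by move/eqP.
pose y n := ((egcdn (x n) (p ^ n)).1 %% p ^ n)%N.
have xy n : (y n * x n = 1 %[mod p ^ n])%N.
  case: n => [|n]; first by rewrite expn0 !modn1.
  rewrite /y modnMml; case: egcdnP => [|a b ab _].
    rewrite lt0n; apply/eqP => xn; apply: x1.
    by rewrite -(prem_modle x (ltn0Sn n)) xn mod0n.
  by rewrite /= ab (eqP (cop _)) modnMDl.
have yP n : (y n.+1 %% p ^ n = y n)%N.
  have /eqP : (y n.+1 = y n %[mod p ^ n])%N.
    apply/eqP; rewrite -[_ == _ %[mod _]](@eqn_modDr 0%N) !addn0.
    have : (y n.+1 * x n == y n * x n %[mod p ^ n])%N.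
      rewrite (xy n) -(premP x n) modnMmr -(modn_dvdm _ (_ : p ^ n %| p ^ n.+1)%N) ?dvdn_exp2l //.
      by rewrite xy modn_dvdm ?dvdn_exp2l.
    set a := y n.+1; set b := y n.
    wlog ab : a b / (b <= a)%N.
      by move=> W; case: (leqP b a) => [/W//|/ltnW/W W']; rewrite eq_sym => /W'; rewrite eq_sym.
    rewrite !eqn_mod_dvd ?leq_mul // -mulnBl Gauss_dvdl // coprime_sym.
    exact: cop.
  by move/eqP ->; rewrite modn_mod.
apply/unitrP; exists (PadicInt p_pr yP).
suff E : PadicInt p_pr yP * x = 1 by rewrite [x * _]mulrC.
by apply: padic_eq => n; rewrite /= xy.
Qed.

Lemma padic_int_factor x : x != 0 ->
  exists n, exists2 u, u \is a GRing.unit & x = p%:R ^+ n * u.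
Proof.
move=> x0; have xn : exists n, x n != 0%N.
  apply: contrapT => H; move/eqP: x0; apply; apply: padic_eq => n.
  by rewrite /= mod0n; apply: contrapT => /eqP ?; apply: H; exists n.
have [[|n] nx nmin] := ex_minnP xn.
  by move: nx; rewrite -prem_mod expn0 modn1.
have [u xu] : exists u, x = p%:R ^+ n * u.
  by apply: padic_dvd; apply/eqP; apply: contraT => /nmin; rewrite ltnn.
exists n, u => //; apply/padic_unitP => u1.
have [z uz] := padic_dvd u1; move/eqP: nx; apply.
by rewrite xu uz mulrA -exprSr /= prem_p modnn mul0n mod0n.
Qed.

Lemma padic_p_neq0 : p%:R != 0 :> Qp.
Proof.
rewrite -(rmorph_nat (padic_of_int (p_pr := p_pr))) tofrac_eq0.
apply/eqP => /(congr1 (fun y : Zp => y 2%N)).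
rewrite -[p%:R]expr1 prem_p /= mod0n modn_small.
  by move/eqP; rewrite expn1 -leqn0 leqNgt prime_gt0.
by rewrite ltn_exp2l ?prime_gt1.
Qed.

Lemma padic_of_int_eq0 x : (padic_of_int x == 0) = (x == 0).
Proof. exact: tofrac_eq0. Qed.

Lemma padic_of_int_inj : injective (@padic_of_int p p_pr).
Proof. by move=> x y /eqP; rewrite tofrac_eq => /eqP. Qed.


Lemma fracE (R : idomainType) (x : {fraction R}) :
  exists a b, b != 0 /\ x = FracField.tofrac a / FracField.tofrac b.
Proof.
elim/quotW: x => r; exists (frac r).1, (frac r).2; split.
  exact: denom_ratioP.
rewrite -[_ / _]/(FracField.mul _ (FracField.inv _)) !piE.
rewrite /FracField.invf /FracField.mulf !numden_Ratio ?oner_eq0 ?denom_ratioP //.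
by rewrite mulr1 mul1r FracField.Ratio_numden.
Qed.

Lemma padic_factor (x : Qp) : x != 0 ->
  exists m : int, exists2 u, u \is a GRing.unit & x = p%:R ^ m * padic_of_int u.
Proof.
have [a [b [b0 ->]]] := fracE x; rewrite mulf_eq0 negb_or tofrac_eq0 => /andP[a0 _].
have [m [u uu ->]] := padic_int_factor a0.
have [n [v vu ->]] := padic_int_factor b0.
exists (m%:Z - n%:Z), (u / v); first by rewrite unitrMl ?unitrV.
have vf : FracField.tofrac v != 0 by rewrite tofrac_eq0; apply: contraTneq vu => ->; rewrite unitr0.
rewrite /padic_of_int !rmorphM rmorphV //= !rmorphXn /= !rmorph_nat.
rewrite expfzDr ?padic_p_neq0 // -exprnN -exprnP invfM.
by rewrite -!mulrA; congr (_ * _); rewrite mulrCA.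
Qed.

Lemma padic_factor_uniq (m n : int) (u v : Zp) :
  u \is a GRing.unit -> v \is a GRing.unit ->
  p%:R ^ m * padic_of_int u = p%:R ^ n * padic_of_int v -> m = n.
Proof.
wlog mn : m n u v / m <= n.
  move=> W uu vu E; case: (lerP m n) => [|/ltW] mn; first exact: W E.
  by apply/esym; apply: W (esym E).
move=> uu vu; have [k ->] : exists k : nat, n = m + k%:Z.
  by exists `|n - m|%N; rewrite gez0_abs ?subr_ge0 // addrCA subrr addr0.
rewrite expfzDr ?padic_p_neq0 // -mulrA => /mulfI.
rewrite expfz_neq0 ?padic_p_neq0 // => /(_ isT).
rewrite -exprnP -(rmorph_nat (padic_of_int (p_pr := p_pr))) -rmorphXn -rmorphM => /padic_of_int_inj.
case: k => [|k] E; first by rewrite addr0.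
have /padic_unitP := uu; rewrite E /= prem_p; case.
by rewrite expnS expn1 modnMr mul0n mod0n.
Qed.

Local Open Scope classical_set_scope.
Local Open Scope relation_scope.

(* x - y lies in p^n Z_p *)
Definition padic_entourage (n : nat) : set (Qp * Qp) :=
  [set xy | exists z : Zp, xy.2 = xy.1 + p%:R ^+ n * padic_of_int z].

Definition padic_ent : set_system (Qp * Qp) :=
  filter_from [set: nat] padic_entourage.

Let pE n (z : Zp) : p%:R ^+ n * padic_of_int z = padic_of_int (p%:R ^+ n * z).
Proof. by rewrite rmorphM rmorphXn /= rmorph_nat. Qed.

Lemma padic_ent_le m n : (m <= n)%N -> padic_entourage n `<=` padic_entourage m.
Proof.
move=> mn [x y] [z /= ->]; exists (p%:R ^+ (n - m) * z).
by rewrite !pE mulrA -exprD subnKC.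
Qed.

Let ent_filter : Filter padic_ent.
Proof.
apply: filter_from_filter => [|m n _ _]; first by exists 0%N.
exists (maxn m n) => // xy H.
by split; apply: padic_ent_le H; rewrite ?leq_maxl ?leq_maxr.
Qed.

Let ent_refl A : padic_ent A -> diagonal `<=` A.
Proof.
move=> [n _ nA] [x y] /= xy; apply: nA; exists 0.
by rewrite rmorph0 mulr0 addr0.
Qed.

Let ent_inv A : padic_ent A -> padic_ent A^-1.
Proof.
move=> [n _ nA]; exists n => // -[x y] [z /= yE]; apply: nA; exists (- z) => /=.
by rewrite yE rmorphN mulrN addrK.
Qed.

Let ent_split A : padic_ent A -> exists2 B, padic_ent B & B \; B `<=` A.
Proof.
move=> [n _ nA]; exists (padic_entourage n); first by exists n.
move=> [x y] [t [z /= tE] [w /= yE]]; apply: nA; exists (z + w) => /=.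
by rewrite yE tE rmorphD mulrDr addrA.
Qed.

HB.instance Definition _ :=
  isUniform.Build Qp ent_filter ent_refl ent_inv ent_split.

Lemma nbhs_padic (x : Qp) A :
  nbhs x A <-> exists n, forall z : Zp, A (x + p%:R ^+ n * padic_of_int z).
Proof.
split=> [/nbhsP[B [n _ nB] BA]|[n nA]].
  by exists n => z; apply/BA/mem_set/nB; exists z.
apply/nbhsP; exists (padic_entourage n); first by exists n.
by move=> y /set_mem[z /= ->]; apply: nA.
Qed.

Definition padic_of_int_mx m n : 'M[Zp]_(m, n) -> 'M[Qp]_(m, n) := map_mx (@padic_of_int p p_pr).

Lemma nbhs_padic_mx m n (M : 'M[Qp]_(m, n)) A :
  nbhs M A <-> exists k, forall N, A (M + p%:R ^+ k *: padic_of_int_mx N).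
Proof.
split=> [[P MP PA]|[k kA]].
  have kP ij : exists k, forall z : Zp, P ij.1 ij.2 (M ij.1 ij.2 + p%:R ^+ k * padic_of_int z).
    exact/nbhs_padic/MP.
  have [f fP] := choice kP.
  exists (\max_ij f ij)%N => N; apply: PA => i j; rewrite !mxE pE.
  have le_f : (f (i, j) <= \max_ij f ij)%N by apply: leq_bigmax.
  by rewrite -(subnKC le_f) exprD -mulrA -pE; apply: (fP (i, j)).
exists (fun i j => [set y | exists z : Zp, y = M i j + p%:R ^+ k * padic_of_int z]).
  by move=> i j; apply/nbhs_padic; exists k => z; exists z.
move=> N NP; have [f fP] := choice (fun ij => NP ij.1 ij.2).
suff -> : N = M + p%:R ^+ k *: padic_of_int_mx (\matrix_(i, j) f (i, j)) by apply: kA.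
by apply/matrixP => i j; rewrite !mxE (fP (i, j)).
Qed.

Lemma mulmxr_continuous m n q (h : 'M[Qp]_(n, q)) :
  continuous (fun g : 'M[Qp]_(m, n) => g *m h).
Proof.
have [k [h' hE]] : exists k h', p%:R ^+ k *: h = padic_of_int_mx h'.
  have dE ij : exists k, exists z : Zp, p%:R ^+ k * h ij.1 ij.2 = padic_of_int z.
    have [->|h0] := eqVneq (h ij.1 ij.2) 0.
      by exists 0%N, 0; rewrite mulr0 rmorph0.
    have [[a|a] [u _ ->]] := padic_factor h0.
      by exists 0%N, (p%:R ^+ a * u); rewrite expr0 mul1r -exprnP pE.
    exists a.+1, u; rewrite NegzE -exprnN mulrA divff ?mul1r //.
    by rewrite expf_neq0 ?padic_p_neq0.
  have [f fP] := choice dE; exists (\max_ij f ij)%N.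
  have {}fP ij : exists z : Zp, p%:R ^+ (\max_ij f ij) * h ij.1 ij.2 = padic_of_int z.
    have [z zE] := fP ij; exists (p%:R ^+ (\max_ij f ij - f ij) * z).
    by rewrite -pE -zE mulrA -exprD subnK // leq_bigmax.
  have [g gP] := choice fP; exists (\matrix_(i, j) g (i, j)).
  by apply/matrixP => i j; rewrite !mxE (gP (i, j)).
move=> M A /nbhs_padic_mx [l lA]; apply/nbhs_padic_mx; exists (k + l)%N => N /=.
rewrite mulmxDl -scalemxAl exprD mulrC -scalerA scalemxAr hE.
by rewrite -map_mxM; apply: lA.
Qed.

Definition intunitmx n : set 'M[Qp]_n :=
  [set g | exists2 k : 'M[Zp]_n, k \in unitmx & g = padic_of_int_mx k].

Lemma ultra_intunitmx n (T : choiceType) (m : T -> 'M[Qp]_n) (F : set_system T) :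
  UltraFilter F -> F (m @^-1` @intunitmx n) ->
  exists2 L, L \in unitmx &
    forall k, F [set t | exists N, m t = padic_of_int_mx L + p%:R ^+ k *: padic_of_int_mx N].
Proof.
move=> FU FI.
pose S := m @^-1` @intunitmx n.
pose kk t : 'M[Zp]_n := xget 0 [set k | k \in unitmx /\ m t = padic_of_int_mx k].
have kkP t : S t -> kk t \in unitmx /\ m t = padic_of_int_mx (kk t).
  by move=> [k ku mk]; rewrite /kk; case: xgetP => [//|/(_ k)]; case.
have ultra_fin (I : finType) (c : T -> I) : exists i, F (c @^-1` [set i]).
  apply: contrapT => H; have {}H i : F (~` (c @^-1` [set i])).
    by have [FA|//] := in_ultra_setVsetC (c @^-1` [set i]) FU; case: H; exists i.
  by have [t /(_ (c t))] := filter_ex (filter_forall _ H); apply.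
have pn_gt0 k : (0 < p ^ k)%N by rewrite expn_gt0 prime_gt0.
have aP (ijk : 'I_n * 'I_n * nat) : exists a : nat,
    F [set t | kk t ijk.1.1 ijk.1.2 ijk.2 = a].
  case: ijk => [[i j] k] /=.
  have lt_t t : (kk t i j k < p ^ k)%N by rewrite -prem_mod ltn_pmod.
  by have [a Fa] := ultra_fin _ (fun t => Ordinal (lt_t t)); exists a;
    apply: filterS Fa => t /= <-.
have [a {}aP] := choice aP.
have coh i j k : (a (i, j, k.+1) %% p ^ k = a (i, j, k))%N.
  have [t [/= <- <-]] := filter_ex (filterI (aP (i, j, k.+1)) (aP (i, j, k))).
  exact: premP.
pose L := \matrix_(i, j) PadicInt p_pr (coh i j).
have FL k : F [set t | S t /\ forall i j, kk t i j k = L i j k].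
  apply: filterI FI _.
  apply: filterS (filter_forall _ (fun i => filter_forall _ (fun j => aP (i, j, k)))).
  by move=> t H i j; rewrite mxE; exact: H.
exists L.
  have [t [St tL]] := filter_ex (FL 1%N); have [ku _] := kkP t St.
  have resE : map_mx (@padic_res p p_pr) (kk t) = map_mx (@padic_res p p_pr) L.
    by apply/matrixP => i j; rewrite [LHS]mxE [RHS]mxE /padic_res tL.
  have : padic_res (\det L) != 0.
    rewrite -det_map_mx -resE det_map_mx; apply: contraTneq ku => E.
    rewrite unitmxE; apply/negP => /(rmorph_unit (@padic_res p p_pr)).
    by rewrite unitfE E eqxx.
  rewrite unitmxE => Lres; apply/padic_unitP => L1.
  by move: Lres; rewrite /padic_res L1 eqxx.
move=> k; apply: filterS (FL k) => t [St tL]; have [_ mE] := kkP t St.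
have [f fP] := choice (fun ij => (padic_int_natP k _ _).1 (esym (tL ij.1 ij.2))).
exists (\matrix_(i, j) f (i, j)); rewrite mE; apply/matrixP => i j.
by rewrite [LHS]mxE (fP (i, j)) rmorphD /= -pE !mxE.
Qed.

End PadicTopology.

Lemma lin_fun0 (E : fieldType) (U V : lmodType E) (f : U -> V) :
  linear f -> f 0 = 0.
Proof.
move=> fl; have := fl (-1) 0 0; rewrite scaler0 addr0 scaleN1r addNr; exact.
Qed.

Record rep (G : groupType) (E : fieldType) := Rep {
  rspace :> lmodType E;
  ract : G -> rspace -> rspace;
  ract_linear : forall g, linear (ract g);
  ract1 : forall v, ract 1%g v = v;
  ractM : forall g h v, ract (g * h)%g v = ract g (ract h v) }.

Record rep_hom (G : groupType) (E : fieldType) (V W : rep G E) := RepHom {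
  rhom :> V -> W;
  rhom_linear : linear rhom;
  rhom_act : forall g v, rhom (ract g v) = ract g (rhom v) }.

Definition rep_iso (G : groupType) (E : fieldType) (V W : rep G E) : Prop :=
  exists f : rep_hom V W, bijective f.

Record subrep (G : groupType) (E : fieldType) (V : rep G E) := SubRep {
  srep :> {pred V};
  srep_submod : submod_closed srep;
  srep_act : forall g v, v \in srep -> ract g v \in srep }.

HB.instance Definition _ G E (V : rep G E) (S : subrep V) :=
  GRing.isSubmodClosed.Build E V (srep S) (srep_submod S).

Section QuotientRep.
Variables (G : groupType) (E : fieldType) (V : rep G E) (S : subrep V).

Lemma ractB g (u v : V) : ract g (u - v) = ract g u - ract g v.
Proof. by rewrite -[u - v]addrC -scaleN1r ract_linear scaleN1r addrC. Qed.

Definition quot_space := Quotient.quot (srep S).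
HB.instance Definition _ := Choice.on quot_space.
HB.instance Definition _ := GRing.Zmodule.on quot_space.
Local Notation pi := (\pi_quot_space)%qT.

Lemma quot_eqP (u v : V) : pi u = pi v <-> u - v \in srep S.
Proof.
rewrite Quotient.idealrBE; split=> [uv|/eqP uv]; last exact: uv.
by apply/eqP; exact: uv.
Qed.

Let piD u v : pi (u + v) = pi u + pi v. Proof. exact: Quotient.pi_add. Qed.

Lemma quot_surj (x : quot_space) : exists v, x = pi v.
Proof. by exists (repr x); rewrite reprK. Qed.

Definition quot_scale (a : E) (x : quot_space) : quot_space :=
  pi (a *: repr x).

Let quot_scaleE a v : quot_scale a (pi v) = pi (a *: v).
Proof.
by apply/quot_eqP; rewrite -scalerBr rpredZ //; apply/quot_eqP; rewrite reprK.
Qed.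

Let scaleA a b x : quot_scale a (quot_scale b x) = quot_scale (a * b) x.
Proof. by have [v ->] := quot_surj x; rewrite !quot_scaleE scalerA. Qed.
Let scale1 : left_id 1 quot_scale.
Proof. by move=> x; have [v ->] := quot_surj x; rewrite quot_scaleE scale1r. Qed.
Let scaleDr : right_distributive quot_scale +%R.
Proof.
move=> a x y; have [u ->] := quot_surj x; have [v ->] := quot_surj y.
by rewrite -piD !quot_scaleE scalerDr piD.
Qed.
Let scaleDl x : {morph quot_scale^~ x : a b / a + b}.
Proof. by move=> a b; have [v ->] := quot_surj x; rewrite !quot_scaleE scalerDl piD. Qed.
HB.instance Definition _ :=
  GRing.Zmodule_isLmodule.Build E quot_space scaleA scale1 scaleDr scaleDl.

Definition quot_act g (x : quot_space) : quot_space := pi (ract g (repr x)).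

Lemma quot_actE g v : quot_act g (pi v) = pi (ract g v).
Proof.
by apply/quot_eqP; rewrite -ractB srep_act //; apply/quot_eqP; rewrite reprK.
Qed.

Let act_linear g : linear (quot_act g).
Proof.
move=> a x y; have [u ->] := quot_surj x; have [v ->] := quot_surj y.
by rewrite -[a *: _]/(quot_scale a _) quot_scaleE -piD !quot_actE ract_linear
  piD -quot_scaleE.
Qed.
Let act1 x : quot_act 1%g x = x.
Proof. by have [v ->] := quot_surj x; rewrite quot_actE ract1. Qed.
Let actM g h x : quot_act (g * h)%g x = quot_act g (quot_act h x).
Proof. by have [v ->] := quot_surj x; rewrite !quot_actE ractM. Qed.

Definition quot_rep : rep G E := Rep act_linear act1 actM.
End QuotientRep.

Section RepConstructions.
Variables (G : groupType) (E : fieldType).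

Section Span.
Variables (V : rep G E) (v : V).

Definition in_span : {pred V} := fun w =>
  `[< exists s : seq (E * G), w = \sum_(a <- s) a.1 *: ract a.2 v >].

Let span_submod : submod_closed in_span.
Proof.
split; first by apply/asboolP; exists [::]; rewrite big_nil.
move=> c u w /asboolP[s ->] /asboolP[t ->]; apply/asboolP.
exists ([seq (c * a.1, a.2) | a <- s] ++ t).
rewrite big_cat big_map scaler_sumr; congr (_ + _).
by apply: eq_bigr => a _; rewrite scalerA.
Qed.
Let span_act g u : u \in in_span -> ract g u \in in_span.
Proof.
move=> /asboolP[s ->]; apply/asboolP; exists [seq (a.1, (g * a.2)%g) | a <- s].
rewrite big_map; elim: s => [|a s IHs]; first by rewrite !big_nil (lin_fun0 (@ract_linear _ _ V g)).
by rewrite !big_cons ract_linear ractM IHs.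
Qed.
Definition span_translates : subrep V := SubRep span_submod span_act.
End Span.

Section Image.
Variables (V W : rep G E) (T : rep_hom V W).
Definition in_image : {pred W} := fun w => `[< exists v, w = T v >].
Let image_submod : submod_closed in_image.
Proof.
split; first by apply/asboolP; exists 0; rewrite (lin_fun0 (@rhom_linear _ _ _ _ T)).
move=> c u w /asboolP[s ->] /asboolP[t ->]; apply/asboolP.
by exists (c *: s + t); rewrite rhom_linear.
Qed.
Let image_act g u : u \in in_image -> ract g u \in in_image.
Proof. by move=> /asboolP[v ->]; apply/asboolP; exists (ract g v); rewrite rhom_act. Qed.
Definition image_rep : subrep W := SubRep image_submod image_act.
End Image.

Section Twist.
Variables (V : rep G E) (c : G -> E).
Hypotheses (c1 : c 1%g = 1) (cM : forall g h, c (g * h)%g = c g * c h).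
Let twist_act g (v : V) := c g *: ract g v.
Let twist_linear g : linear (twist_act g).
Proof. by move=> a u v; rewrite /twist_act ract_linear scalerDr !scalerA mulrC. Qed.
Let twist1 v : twist_act 1%g v = v.
Proof. by rewrite /twist_act c1 scale1r ract1. Qed.
Let ractZ g a (v : V) : ract g (a *: v) = a *: ract g v.
Proof.
by rewrite -[a *: v]addr0 ract_linear (lin_fun0 (@ract_linear _ _ V g)) addr0.
Qed.
Let twistM g h v : twist_act (g * h)%g v = twist_act g (twist_act h v).
Proof. by rewrite /twist_act cM ractM ractZ scalerA. Qed.
Definition twist_rep : rep G E := Rep twist_linear twist1 twistM.
End Twist.
End RepConstructions.

Section Restriction.
Variables (H G : groupType) (E : fieldType) (f : H -> G).
Hypotheses (f1 : f 1%g = 1%g) (fM : forall g h, f (g * h)%g = (f g * f h)%g).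
Variable V : rep G E.
Let res_act g (v : V) := ract (f g) v.
Let res_linear g : linear (res_act g). Proof. exact: ract_linear. Qed.
Let res1 v : res_act 1%g v = v. Proof. by rewrite /res_act f1 ract1. Qed.
Let resM g h v : res_act (g * h)%g v = res_act g (res_act h v).
Proof. by rewrite /res_act fM ractM. Qed.
Definition res_rep : rep H E := Rep res_linear res1 resM.
End Restriction.


(* Compactness of supports refers to the topology of G; right translations must
   be continuous for G to act on the compact induction. *)
HB.mixin Record hasContinuousTranslations G of Group G & Topological G := {
  mulg_continuous : forall h : G, continuous (fun g : G => (g * h)%g) }.

#[short(type="rtopGroupType")]
HB.structure Definition RTopGroup :=
  {G of Group G & Topological G & hasContinuousTranslations G}.

Section CompactInductionData.
Local Open Scope classical_set_scope.

Definition subgroup_set (G : groupType) (H : set G) :=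
  [/\ H 1%g, forall g h, H g -> H h -> H (g * h)%g & forall g, H g -> H g^-1%g].

(* K compact and Z central; the compact induction is from KZ to G, with
   supports compact modulo Z. *)
Record KZpair (G : rtopGroupType) := MkKZpair {
  KZ_K : set G;
  KZ_Z : set G;
  KZ_K_group : subgroup_set KZ_K;
  KZ_Z_group : subgroup_set KZ_Z;
  KZ_Z_central : forall z g, KZ_Z z -> (z * g = g * z)%g;
  KZ_K_compact : compact KZ_K }.

Definition KZset (G : rtopGroupType) (KZ : KZpair G) : set G :=
  [set g | exists2 k, KZ_K KZ k & exists2 z, KZ_Z KZ z & g = (k * z)%g].

(* A representation of KZ; the values of kzact outside of KZ are irrelevant. *)
Record KZrep (G : rtopGroupType) (KZ : KZpair G) (E : fieldType) := MkKZrep {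
  kzspace :> lmodType E;
  kzact : G -> kzspace -> kzspace;
  kzact_linear : forall g, linear (kzact g);
  kzact1 : forall v, kzact 1%g v = v;
  kzactM : forall g h v, KZset KZ g -> KZset KZ h ->
    kzact (g * h)%g v = kzact g (kzact h v) }.

End CompactInductionData.

Section CompactInduction.
Local Open Scope classical_set_scope.
Variables (G : rtopGroupType) (KZ : KZpair G) (E : fieldType).
Variable sigma : KZrep KZ E.
Local Notation H := (KZset KZ).
Local Notation Z := (KZ_Z KZ).

Definition equivariant (f : G -> sigma) :=
  forall k g, H k -> f (k * g)%g = kzact k (f g).

(* The support of f has compact image modulo Z: it lies in ZC for a compact C. *)
Definition compact_mod_Z (f : G -> sigma) :=
  exists2 C : set G, compact C &
    forall g, f g <> 0 -> exists2 z, Z z & exists2 c, C c & g = (z * c)%g.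

Definition cind_mem : {pred G -> sigma} :=
  fun f => `[< equivariant f /\ compact_mod_Z f >].

Lemma cind_submod : submod_closed cind_mem.
Proof.
have lin0 k : kzact k 0 = 0 :> sigma.
  exact: lin_fun0 (@kzact_linear _ _ _ sigma k).
split.
  apply/asboolP; split=> [k g _|]; first by rewrite lin0.
  by exists set0; [exact: compact0|].
move=> a f h /asboolP[fE [C Cc fC]] /asboolP[hE [D Dc hD]]; apply/asboolP; split.
  by move=> k g Hk; rewrite -[LHS]/(a *: f _ + h _) fE // hE // -kzact_linear.
exists (C `|` D); first exact: compactU.
move=> g; rewrite -[(_ + _) g]/(a *: f g + h g).
have [fg0|/fC[z Zz [c Cc' gE]] _] := pselect (f g = 0).
  rewrite fg0 scaler0 add0r => /hD[z Zz [c Cc' gE]].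
  by exists z => //; exists c => //; right.
by exists z => //; exists c => //; left.
Qed.

HB.instance Definition _ :=
  GRing.isSubmodClosed.Build E (G -> sigma) cind_mem cind_submod.

Record cind := Cind { cind_fun :> G -> sigma; cindP : cind_fun \in cind_mem }.
HB.instance Definition _ := [isSub for cind_fun].
HB.instance Definition _ := [Choice of cind by <:].
HB.instance Definition _ := [SubChoice_isSubLmodule of cind by <:].

Lemma cind_act_subproof (g : G) (f : cind) :
  (fun h => f (h * g)%g) \in cind_mem.
Proof.
have [fE [C Cc fC]] := asboolP _ (cindP f); apply/asboolP; split.
  by move=> k h Hk; rewrite -fE // mulgA.
exists ((fun h => h * g^-1)%g @` C).
  apply: continuous_compact => //; apply: continuous_subspaceT.
  exact: mulg_continuous.
move=> h /fC[z Zz [c Cc' hE]]; exists z => //; exists (c * g^-1)%g.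
  by exists c.
by rewrite mulgA -hE mulgK.
Qed.
Definition cind_act g f := Cind (cind_act_subproof g f).

Let cact_linear g : linear (cind_act g). Proof. by move=> a u v; apply: val_inj. Qed.
Let cact1 f : cind_act 1%g f = f.
Proof. by apply: val_inj; apply/funext => h /=; rewrite mulg1. Qed.
Let cactM g h f : cind_act (g * h)%g f = cind_act g (cind_act h f).
Proof. by apply: val_inj; apply/funext => x /=; rewrite mulgA. Qed.
Definition cind_rep : rep G E := Rep cact_linear cact1 cactM.

Lemma KZ_subgroup : subgroup_set H.
Proof.
have [K1 KM KV] := KZ_K_group KZ; have [Z1 ZM ZV] := KZ_Z_group KZ.
have ZC := @KZ_Z_central _ KZ.
split.
- by exists 1%g => //; exists 1%g => //; rewrite mulg1.
- move=> _ _ [k Kk [z Zz ->]] [k' Kk' [z' Zz' ->]].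
  exists (k * k')%g; first exact: KM.
  exists (z * z')%g; first exact: ZM.
  by rewrite -!mulgA; congr (_ * _)%g; rewrite !mulgA (KZ_Z_central _ Zz).
- move=> _ [k Kk [z Zz ->]]; exists k^-1%g; first exact: KV.
  by exists z^-1%g; [exact: ZV|rewrite invgM (KZ_Z_central _ (ZV _ Zz))].
Qed.

Definition brac_fun (g : G) (v : sigma) (h : G) : sigma :=
  if `[< H (h * g)%g >] then kzact (h * g)%g v else 0.

Lemma brac_subproof g v : brac_fun g v \in cind_mem.
Proof.
have [H1 HM HV] := KZ_subgroup; apply/asboolP; split.
  move=> k h Hk; rewrite /brac_fun -mulgA; case: asboolP => Hkh.
    have Hhg : H (h * g)%g by rewrite -[(h * g)%g](mulKg k); apply: HM => //; exact: HV.
    by rewrite (asboolT Hhg); exact: kzactM.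
  case: asboolP => Hhg; first by case: Hkh; apply: HM.
  by rewrite (lin_fun0 (@kzact_linear _ _ _ sigma k)).
exists ((fun h => h * g^-1)%g @` KZ_K KZ).
  apply: continuous_compact; last exact: KZ_K_compact.
  by apply: continuous_subspaceT; exact: mulg_continuous.
move=> h; rewrite /brac_fun; case: asboolP => // -[k Kk [z Zz hgE]] _.
exists z => //; exists (k * g^-1)%g; first by exists k.
by rewrite mulgA (KZ_Z_central _ Zz) -hgE mulgK.
Qed.

(* [g, v]: h |-> sigma(hg) v on KZ g^-1, and 0 elsewhere *)
Definition brac g v : cind_rep := Cind (brac_subproof g v).

End CompactInduction.


Section GL2.
Variables (p : nat) (p_pr : prime p).
Local Notation Zp := (padic_int p_pr).
Local Notation Qp := (padic p_pr).

Record GL2 := MkGL2 { gl2_mx :> 'M[Qp]_2; gl2_unit : gl2_mx \in unitmx }.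
HB.instance Definition _ := [isSub for gl2_mx].
HB.instance Definition _ := [Choice of GL2 by <:].

Let gl2_mul_unit (g h : GL2) : g *m h \in unitmx.
Proof. by rewrite unitmx_mul !gl2_unit. Qed.
Let gl2_inv_unit (g : GL2) : invmx g \in unitmx.
Proof. by rewrite unitmx_inv gl2_unit. Qed.
Definition gl2_one := MkGL2 (unitmx1 _ 2).
Definition gl2_mul g h := MkGL2 (gl2_mul_unit g h).
Definition gl2_inv g := MkGL2 (gl2_inv_unit g).
Let gl2_mulA : associative gl2_mul.
Proof. by move=> x y z; apply: val_inj; rewrite /= mulmxA. Qed.
Let gl2_mul1g : left_id gl2_one gl2_mul.
Proof. by move=> x; apply: val_inj; rewrite /= mul1mx. Qed.
Let gl2_mulg1 : right_id gl2_one gl2_mul.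
Proof. by move=> x; apply: val_inj; rewrite /= mulmx1. Qed.
Let gl2_mulVg : left_inverse gl2_one gl2_inv gl2_mul.
Proof. by move=> x; apply: val_inj; rewrite /= mulVmx ?gl2_unit. Qed.
Let gl2_mulgV : right_inverse gl2_one gl2_inv gl2_mul.
Proof. by move=> x; apply: val_inj; rewrite /= mulmxV ?gl2_unit. Qed.
HB.instance Definition _ :=
  isGroup.Build GL2 gl2_mulA gl2_mul1g gl2_mulg1 gl2_mulVg gl2_mulgV.

HB.instance Definition _ := Topological.copy GL2 (initial_topology gl2_mx).

Let gl2_continuous (h : GL2) : continuous (fun g : GL2 => (g * h)%g).
Proof.
apply: (@continuous_comp_initial _ _ _ gl2_mx).
move=> g; apply: (@continuous_comp GL2 _ _ gl2_mx (fun x => x *m gl2_mx h)).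
  exact: initial_continuous.
exact: mulmxr_continuous.
Qed.
HB.instance Definition _ := hasContinuousTranslations.Build GL2 gl2_continuous.

Lemma mulmx2E (R : pzRingType) (A B : 'M[R]_2) i j :
  (A *m B) i j = A i 0 * B 0 j + A i 1 * B 1 j.
Proof. by rewrite mxE 2!big_ord_recl big_ord0 addr0; congr (_ + A i _ * B _ j); apply: val_inj. Qed.

Record borel := MkBorel { borel_gl :> GL2; borelP : borel_gl 1 0 == 0 }.
HB.instance Definition _ := [isSub for borel_gl].
HB.instance Definition _ := [Choice of borel by <:].

Lemma borel10 (g : borel) : g 1 0 = 0. Proof. exact/eqP/borelP. Qed.

Let gl2_mulE (g h : GL2) : (g * h)%g = g *m h :> 'M_2. Proof. by []. Qed.

Lemma borel11_neq0 (g : borel) : g 1 1 != 0.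
Proof.
have := congr1 (fun h : GL2 => h 1 1) (mulgV (borel_gl g)).
rewrite gl2_mulE mulmx2E borel10 mul0r add0r mxE /= => H; apply/eqP => g11.
by move: H; rewrite g11 mul0r => /esym/eqP; rewrite oner_eq0.
Qed.

Lemma borel00_neq0 (g : borel) : g 0 0 != 0.
Proof.
have := congr1 (fun h : GL2 => h 0 0) (mulVg (borel_gl g)).
rewrite gl2_mulE mulmx2E borel10 mulr0 addr0 mxE /= => H; apply/eqP => g00.
by move: H; rewrite g00 mulr0 => /esym/eqP; rewrite oner_eq0.
Qed.

Let borel_mul_subproof (g h : borel) : (borel_gl g * borel_gl h)%g 1 0 == 0.
Proof. by rewrite gl2_mulE mulmx2E !borel10 mulr0 mul0r addr0. Qed.
Let borel_inv_subproof (g : borel) : (borel_gl g)^-1%g 1 0 == 0.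
Proof.
have /eqP := congr1 (fun h : GL2 => h 1 0) (mulgV (borel_gl g)).
rewrite gl2_mulE mulmx2E borel10 mul0r add0r mxE /=.
by rewrite mulf_eq0 (negPf (borel11_neq0 g)).
Qed.
Let borel_one_subproof : (1%g : GL2) 1 0 == 0.
Proof. by rewrite mxE. Qed.
Definition borel_one := MkBorel borel_one_subproof.
Definition borel_mul g h := MkBorel (borel_mul_subproof g h).
Definition borel_inv g := MkBorel (borel_inv_subproof g).
Let borel_mulA : associative borel_mul.
Proof. by move=> x y z; apply: val_inj; rewrite /= mulgA. Qed.
Let borel_mul1g : left_id borel_one borel_mul.
Proof. by move=> x; apply: val_inj; rewrite /= mul1g. Qed.
Let borel_mulg1 : right_id borel_one borel_mul.
Proof. by move=> x; apply: val_inj; rewrite /= mulg1. Qed.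
Let borel_mulVg : left_inverse borel_one borel_inv borel_mul.
Proof. by move=> x; apply: val_inj; rewrite /= mulVg. Qed.
Let borel_mulgV : right_inverse borel_one borel_inv borel_mul.
Proof. by move=> x; apply: val_inj; rewrite /= mulgV. Qed.
HB.instance Definition _ :=
  isGroup.Build borel borel_mulA borel_mul1g borel_mulg1 borel_mulVg borel_mulgV.

Definition borel_mx (g : borel) : 'M[Qp]_2 := g.
HB.instance Definition _ := Topological.copy borel (initial_topology borel_mx).

Let borel_continuous (h : borel) : continuous (fun g : borel => (g * h)%g).
Proof.
apply: (@continuous_comp_initial _ _ _ borel_mx).
move=> g; apply: (@continuous_comp borel _ _ borel_mx (fun x => x *m borel_mx h)).
  exact: initial_continuous.
exact: mulmxr_continuous.
Qed.
HB.instance Definition _ := hasContinuousTranslations.Build borel borel_continuous.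

Local Open Scope classical_set_scope.

(* A set of integral unimodular matrices is compact as soon as it contains
   the limits of its ultrafilters. *)
Let compact_intunit (G : choiceType) (m : G -> 'M[Qp]_2)
    (K : set (initial_topology m)) :
  (forall g, K g -> intunitmx (m g)) ->
  (forall L, L \in unitmx ->
     (forall k, exists2 g, K g &
        exists N, m g = padic_of_int_mx L + p%:R ^+ k *: padic_of_int_mx N) ->
     exists2 g, K g & m g = padic_of_int_mx L) ->
  compact K.
Proof.
move=> Kint Klim; rewrite compact_ultra => F FU FK.
have [L Lu LF] := ultra_intunitmx FU (filterS Kint FK).
have [g Kg mg] : exists2 g, K g & m g = padic_of_int_mx L.
  apply: Klim => // k; have [g [Kg gN]] := filter_ex (filterI FK (LF k)).
  by exists g.
exists g; split=> // U [?/= [[W oW <-]]] /= Wg /filterS; apply.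
have /nbhs_padic_mx [k kW] : nbhs (m g) W by apply: open_nbhs_nbhs.
by apply: filterS (LF k) => h [N hN]; rewrite /= hN -mg; apply: kW.
Qed.

Let padic_of_int_mx_unit (L : 'M[Zp]_2) : L \in unitmx -> padic_of_int_mx L \in unitmx.
Proof. by rewrite !unitmxE det_map_mx => /rmorph_unit; apply. Qed.

Definition GL2Zp : set GL2 := [set g | intunitmx (gl2_mx g)].
Definition scalars : set GL2 := [set g | exists a : Qp, g = a%:M :> 'M_2].

Let GL2Zp_group : subgroup_set GL2Zp.
Proof.
split.
- by exists 1%:M; rewrite ?unitmx1 // /padic_of_int_mx map_mx1.
- move=> g h [k ku gk] [l lu hl]; exists (k *m l); first by rewrite unitmx_mul ku.
  by rewrite gl2_mulE gk hl /padic_of_int_mx map_mxM.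
- move=> g [k ku gk]; exists (invmx k); first by rewrite unitmx_inv.
  have U : padic_of_int_mx k \in unitmx by apply: padic_of_int_mx_unit.
  rewrite /= gk -[RHS]mul1mx -(mulVmx U) -mulmxA -map_mxM mulmxV //.
  by rewrite map_mx1 mulmx1.
Qed.
Let scalars_group : subgroup_set scalars.
Proof.
split.
- by exists 1.
- move=> g h [a ga] [b hb]; exists (a * b).
  by rewrite gl2_mulE ga hb -scalar_mxM.
- by move=> g [a ga]; exists a^-1; rewrite /= ga invmx_scalar.
Qed.
Let scalars_central z g : scalars z -> (z * g = g * z)%g.
Proof. by move=> [a za]; apply: val_inj; rewrite /= za scalar_mxC. Qed.
Let GL2Zp_compact : compact GL2Zp.
Proof.
apply: (@compact_intunit GL2 gl2_mx) => // L Lu _.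
by exists (MkGL2 (padic_of_int_mx_unit Lu)) => //; exists L.
Qed.
Definition GL2_KZ : KZpair GL2 :=
  MkKZpair GL2Zp_group scalars_group scalars_central GL2Zp_compact.

Let borel_K_group : subgroup_set (borel_gl @^-1` GL2Zp).
Proof. by have [H1 HM HV] := GL2Zp_group; split=> *; [exact: H1|exact: HM|exact: HV]. Qed.
Let borel_Z_group : subgroup_set (borel_gl @^-1` scalars).
Proof. by have [H1 HM HV] := scalars_group; split=> *; [exact: H1|exact: HM|exact: HV]. Qed.
Let borel_Z_central z g : (borel_gl @^-1` scalars) z -> (z * g = g * z)%g.
Proof. by move=> Zz; apply: val_inj; apply: scalars_central. Qed.
Let borel_K_compact : compact (borel_gl @^-1` GL2Zp).
Proof.
apply: (@compact_intunit borel borel_mx) => // L Lu Llim.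
have L10 : (MkGL2 (padic_of_int_mx_unit Lu)) 1 0 == 0.
  rewrite mxE padic_of_int_eq0; apply/eqP/padic_eq => k.
  have [g _ [N /(congr1 (fun M : 'M_2 => M 1 0))]] := Llim k.
  rewrite /borel_mx borel10 !mxE -(rmorph_nat (padic_of_int (p_pr := p_pr))).
  rewrite -rmorphXn -rmorphM -rmorphD -(rmorph0 (padic_of_int (p_pr := p_pr))).
  move=> /padic_of_int_inj LN; apply/padic_int_natP; by exists (N 1 0).
by exists (MkBorel L10) => //; exists L.
Qed.
Definition borel_KZ : KZpair borel :=
  MkKZpair borel_K_group borel_Z_group borel_Z_central borel_K_compact.

End GL2.


Section Characters.
Variables (p : nat) (p_pr : prime p) (E : fieldExtType 'F_p).
Local Notation Zp := (padic_int p_pr).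
Local Notation Qp := (padic p_pr).

(* Characters of Q_p^*; the value at 0 is irrelevant. *)
Record qpchar := MkQpChar {
  qpchar_fun :> Qp -> E;
  qpchar_neq0 : forall x, x != 0 -> qpchar_fun x != 0;
  qpcharM : forall x y, x != 0 -> y != 0 ->
    qpchar_fun (x * y) = qpchar_fun x * qpchar_fun y }.

Lemma qpchar1 (chi : qpchar) : chi 1 = 1.
Proof.
apply: (mulfI (qpchar_neq0 chi (oner_neq0 _))).
by rewrite -qpcharM ?oner_eq0 // !mulr1.
Qed.

(* Locally constant, E^* being discrete: the kernel is open in Q_p^*. *)
Definition smooth (chi : qpchar) : Prop :=
  open [set x : Qp | x != 0 /\ chi x = 1]%classic.

Let mul_neq0 (a b : qpchar) x : x != 0 -> a x * b x != 0.
Proof. by move=> x0; rewrite mulf_neq0 // qpchar_neq0. Qed.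
Let mul_mul (a b : qpchar) x y : x != 0 -> y != 0 ->
  a (x * y) * b (x * y) = (a x * b x) * (a y * b y).
Proof. by move=> x0 y0; rewrite !qpcharM // mulrACA. Qed.
Definition qpchar_mul a b := MkQpChar (@mul_neq0 a b) (@mul_mul a b).

Let exp_neq0 (a : qpchar) n x : x != 0 -> a x ^+ n != 0.
Proof. by move=> x0; rewrite expf_neq0 // qpchar_neq0. Qed.
Let exp_mul (a : qpchar) n x y : x != 0 -> y != 0 ->
  a (x * y) ^+ n = a x ^+ n * a y ^+ n.
Proof. by move=> x0 y0; rewrite qpcharM // exprMn. Qed.
Definition qpchar_exp a n := MkQpChar (@exp_neq0 a n) (@exp_mul a n).

(* The u in Z_p^* of x = p^m u, which is unique for x != 0. *)
Definition unit_part (x : Qp) : Zp :=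
  xget 1 [set u | u \is a GRing.unit /\ exists m : int, x = p%:R ^ m * padic_of_int u]%classic.

Lemma unit_partP (x : Qp) : x != 0 -> unit_part x \is a GRing.unit /\
  exists m : int, x = p%:R ^ m * padic_of_int (unit_part x).
Proof.
move=> /padic_factor[m [u uu xE]]; rewrite /unit_part.
by case: xgetP => [//|/(_ u)]; case; split => //; exists m.
Qed.

Lemma unit_part_eq (m : int) u : u \is a GRing.unit ->
  unit_part (p%:R ^ m * padic_of_int u) = u.
Proof.
move=> uu; set x := _ * _; have x0 : x != 0.
  rewrite mulf_neq0 ?expfz_neq0 ?padic_p_neq0 // padic_of_int_eq0.
  by apply: contraTneq uu => ->; rewrite unitr0.
have [vu [n xE]] := unit_partP x0; rewrite {1}/x in xE.
have mn := padic_factor_uniq uu vu xE; apply: (@padic_of_int_inj p p_pr).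
by move: xE; rewrite -mn => /(mulfI (expfz_neq0 _ (padic_p_neq0 p_pr))) <-.
Qed.

Lemma unit_partM x y : x != 0 -> y != 0 ->
  unit_part (x * y) = unit_part x * unit_part y.
Proof.
move=> /unit_partP[u [m {1}->]] /unit_partP[v [n {1}->]].
rewrite mulrACA -expfzDr ?padic_p_neq0 // -rmorphM unit_part_eq //.
by rewrite unitrM u v.
Qed.

Let omega_fun (x : Qp) : E := in_alg E (padic_res (unit_part x)).
Let omega_neq0 x : x != 0 -> omega_fun x != 0.
Proof.
move=> /unit_partP[u _]; rewrite fmorph_eq0 -unitfE.
exact: (rmorph_unit (@padic_res p p_pr)).
Qed.
Let omega_mul x y : x != 0 -> y != 0 -> omega_fun (x * y) = omega_fun x * omega_fun y.
Proof. by move=> x0 y0; rewrite /omega_fun unit_partM // !rmorphM. Qed.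
Definition omega := MkQpChar omega_neq0 omega_mul.

End Characters.

Section Representations.
Variables (p : nat) (p_pr : prime p) (E : fieldExtType 'F_p).
Local Notation Zp := (padic_int p_pr).
Local Notation Qp := (padic p_pr).
Local Notation GL2 := (GL2 p_pr).
Local Notation B := (borel p_pr).

Section Tensor.
Variables s1 s2 : qpchar p_pr E.
Let tensor_act (g : B) (v : E^o) : E^o := (s1 (g 0 0) * s2 (g 1 1)) *: v.
Let tensor_linear g : linear (tensor_act g).
Proof. by move=> a u v; rewrite /tensor_act scalerDr !scalerA mulrC. Qed.
Let tensor1 v : tensor_act 1%g v = v.
Proof. by rewrite /tensor_act !mxE !qpchar1 mulr1 scale1r. Qed.
Let tensorM (g h : B) v : KZset (borel_KZ p_pr) g -> KZset (borel_KZ p_pr) h ->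
  tensor_act (g * h)%g v = tensor_act g (tensor_act h v).
Proof.
move=> _ _; rewrite /tensor_act /= !mulmx2E !borel10 mulr0 mul0r addr0 add0r.
by rewrite !qpcharM ?borel00_neq0 ?borel11_neq0 // scalerA mulrACA.
Qed.
Definition tensor : KZrep (borel_KZ p_pr) E :=
  MkKZrep tensor_linear tensor1 tensorM.
End Tensor.

Definition utri_mx (a b d : Qp) : 'M[Qp]_2 :=
  \matrix_(i, j) (if i == 0 then if j == 0 then a else b
                  else if j == 0 then 0 else d).

Lemma utri_unit a b d : a != 0 -> d != 0 -> utri_mx a b d \in unitmx.
Proof.
move=> a0 d0; pose M := utri_mx a^-1 (- (a^-1 * b * d^-1)) d^-1.
have : utri_mx a b d *m M = 1%:M.
  apply/matrixP => -[[|[|//]] i2] [[|[|//]] j2]; rewrite mulmx2E !mxE /=.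
  - by rewrite mulr0 addr0 divff.
  - by rewrite mulrN !mulrA divff // mul1r addNr.
  - by rewrite mul0r mulr0 addr0.
  - by rewrite mul0r add0r divff.
by move=> H; have [U _] := mulmx1_unit H; exact: U.
Qed.
Lemma utri10 a b d : utri_mx a b d 1 0 == 0.
Proof. by rewrite mxE. Qed.

(* (a b ; 0 d) *)
Definition utri a b d (a0 : a != 0) (d0 : d != 0) : B :=
  @MkBorel _ _ (MkGL2 (utri_unit b a0 d0)) (utri10 a b d).

Lemma pX_neq0 n : p%:R ^+ n != 0 :> Qp.
Proof. by rewrite expf_neq0 ?padic_p_neq0. Qed.

(* (1 -j p^-2 ; 0 1) *)
Definition utri_w (j : nat) : B :=
  utri (- (j%:R * p%:R ^- 2)) (oner_neq0 _) (oner_neq0 _).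
(* (1 0 ; 0 p^n) *)
Definition utri_1p (n : nat) : B := utri 0 (oner_neq0 _) (pX_neq0 n).
(* (p j ; 0 1) *)
Definition utri_p1 (j : nat) : B := utri j%:R (pX_neq0 1) (oner_neq0 _).

Section Pi2.
Variables s1 s2 : qpchar p_pr E.
Local Notation ind := (cind_rep (tensor s1 s2)).

(* [g] is [g, 1], the function h |-> sigma(hg) on KZg^-1. *)
Definition brac1 (g : B) : ind := brac (sigma := tensor s1 s2) g (1 : E^o).

Definition w2 (l : nat) : ind := \sum_(j < p ^ 2) ('C(j, l)%:R : E) *: brac1 (utri_w j).

(* lambda is s1 p; this is meant for s1 p = s2 p. *)
Definition S2 (h : nat) : subrep ind :=
  span_translates ((s1 p%:R ^- 2) *: brac1 (utri_1p 2) + w2 (h * p.-1)%N).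

Definition Pi2 (h : nat) : rep B E := quot_rep (S2 h).
End Pi2.

Section Sym.
Variable r : nat.
Local Notation X i := (mpolyX E (mnm1 i) : mpoly 2 E).

(* The images a x + c y and b x + d y of x and y under (a b ; c d). *)
Definition lin_subst (k : 'M[E]_2) : 2.-tuple (mpoly 2 E) :=
  [tuple \sum_(j < 2) k j i *: X j | i < 2].

Lemma lin_subst_dhomog k (P : dhomog 2 E r) :
  comp_mpoly (lin_subst k) (mpoly_of_dhomog P) \is @ishomog1 2 E r mdeg.
Proof.
rewrite comp_mpolyE big_seq rpred_sum // => m mP; apply: dhomogZ.
have lin1 i : tnth (lin_subst k) i \is @ishomog1 2 E 1 mdeg.
  rewrite tnth_mktuple rpred_sum // => j _; apply: dhomogZ.
  by rewrite dhomogX /= mdeg1.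
have mr : mdeg m = r.
  by have /dhomogP/(_ m mP) := dhomog_is_dhomog P.
rewrite -mr mdegE 2!big_ord_recl big_ord0 2!big_ord_recl big_ord0 mulr1 addn0.
by apply: dhomogM; rewrite -[Y in ishomog1 Y _]mul1n; apply: dhomogMn.
Qed.

Definition lin_act k (P : dhomog 2 E r) : dhomog 2 E r := DHomog (lin_subst_dhomog k P).

Lemma lin_act_linear k : linear (lin_act k).
Proof. by move=> a u v; apply: val_inj; rewrite /= linearP. Qed.

Lemma lin_act1 P : lin_act 1%:M P = P.
Proof.
apply: val_inj => /=; rewrite -[RHS]comp_mpoly_id; congr (comp_mpoly _ _).
apply: eq_from_tnth => i; rewrite !tnth_mktuple (bigD1 i) //= mxE eqxx scale1r.
by rewrite big1 ?addr0 // => j ji; rewrite mxE (negPf ji) scale0r.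
Qed.
Lemma lin_actM k l P : lin_act (k *m l) P = lin_act k (lin_act l P).
Proof.
apply: val_inj => /=; rewrite [LHS]comp_mpolyEX.
rewrite [comp_mpoly (lin_subst l) _]comp_mpolyEX raddf_sum /=.
apply: eq_bigr => m _; rewrite comp_mpolyZ; congr (_ *: _).
rewrite !comp_mpolyX rmorph_prod; apply: eq_bigr => i _.
rewrite rmorphXn /=; congr (_ ^+ _); rewrite !tnth_mktuple raddf_sum /=.
transitivity (\sum_(a < 2) \sum_(j < 2) (k a j * l j i) *: X a).
  by apply: eq_bigr => a _; rewrite mxE scaler_suml.
rewrite exchange_big; apply: eq_bigr => j _.
rewrite comp_mpolyZ comp_mpolyXU -tnth_nth tnth_mktuple scaler_sumr.
by apply: eq_bigr => a _; rewrite scalerA mulrC.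
Qed.

(* The k in GL_2(Z_p) of g = p^m k, which is unique for g in GL_2(Z_p)Z. *)
Definition unimod_part (g : GL2) : 'M[Zp]_2 :=
  xget 1%:M [set k | k \in unitmx /\
    exists m : int, gl2_mx g = p%:R ^ m *: padic_of_int_mx k]%classic.

Definition red_mx (k : 'M[Zp]_2) : 'M[E]_2 :=
  map_mx (in_alg E \o @padic_res p p_pr) k.

Definition sym_act (g : GL2) (P : dhomog 2 E r) : dhomog 2 E r :=
  lin_act (red_mx (unimod_part g)) P.

Let sym_act_linear g : linear (sym_act g).
Proof. exact: lin_act_linear. Qed.

Lemma KZ_unimod g : KZset (GL2_KZ p_pr) g -> exists2 k : 'M[Zp]_2, k \in unitmx &
  exists m : int, gl2_mx g = p%:R ^ m *: padic_of_int_mx k.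
Proof.
move=> [h [k ku hk] [z [a za] ->]].
have a0 : a != 0.
  by have := gl2_unit z; rewrite za unitmxE det_scalar unitfE expf_eq0.
have [m [u uu aE]] := padic_factor a0.
exists (u *: k); first by rewrite unitmxZ.
exists m; rewrite /= hk za mul_mx_scalar aE -scalerA; congr (_ *: _).
by apply/matrixP => i j; rewrite !mxE rmorphM.
Qed.
Lemma unimod_part_eq (m : int) (g : GL2) (k : 'M[Zp]_2) : k \in unitmx ->
  gl2_mx g = p%:R ^ m *: padic_of_int_mx k -> unimod_part g = k.
Proof.
move=> ku gE; rewrite /unimod_part.
case: xgetP => [l _ [lu [n gE']]|/(_ k)]; last by case; split => //; exists m.
have det_unit (x : 'M[Zp]_2) : x \in unitmx -> \det x \is a GRing.unit by rewrite unitmxE.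
have detE (i : int) x : gl2_mx g = p%:R ^ i *: padic_of_int_mx x ->
    \det (gl2_mx g) = p%:R ^ (i * 2%:Z) * padic_of_int (\det x).
  by move=> ->; rewrite detZ det_map_mx -exprz_exp.
have mn2 : m * 2%:Z = n * 2%:Z.
  apply: (padic_factor_uniq (det_unit _ ku) (det_unit _ lu)).
  by rewrite -(detE _ _ gE) -(detE _ _ gE').
have mn : m = n by apply: (mulIf (isT : 2%:Z != 0)).
move: gE'; rewrite gE mn => E'.
apply/matrixP => i j; apply: (@padic_of_int_inj p p_pr).
have /matrixP/(_ i j) := E'; rewrite !mxE.
by move/(mulfI (expfz_neq0 _ (padic_p_neq0 p_pr))).
Qed.
Let sym_act1 P : sym_act 1%g P = P.
Proof.
rewrite /sym_act (@unimod_part_eq 0 _ 1%:M) ?unitmx1 //.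
  by rewrite /red_mx map_mx1 lin_act1.
by rewrite expr0z scale1r /padic_of_int_mx map_mx1.
Qed.
Let sym_actM g h P : KZset (GL2_KZ p_pr) g -> KZset (GL2_KZ p_pr) h ->
  sym_act (g * h)%g P = sym_act g (sym_act h P).
Proof.
move=> /KZ_unimod[k ku [m gE]] /KZ_unimod[l lu [n hE]].
rewrite /sym_act (unimod_part_eq ku gE) (unimod_part_eq lu hE).
rewrite (@unimod_part_eq (m + n) _ (k *m l)) ?unitmx_mul ?ku //.
  by rewrite /red_mx map_mxM lin_actM.
rewrite /= gE hE -scalemxAl -scalemxAr scalerA -expfzDr ?padic_p_neq0 //.
by rewrite /padic_of_int_mx map_mxM.
Qed.
Definition Sym : KZrep (GL2_KZ p_pr) E := MkKZrep sym_act_linear sym_act1 sym_actM.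

Lemma sym_mono_dhomog (i : 'I_r.+1) : X 0 ^+ (r - i) * X 1 ^+ i \is @ishomog1 2 E r mdeg.
Proof.
have X1 j : X j \is @ishomog1 2 E 1 mdeg by rewrite dhomogX /= mdeg1.
have H : X 0 ^+ (r - i) * X 1 ^+ i \is @ishomog1 2 E (1 * (r - i) + 1 * i)%N mdeg.
  by apply: dhomogM; apply: dhomogMn.
by have ir : (i <= r)%N := ltn_ord i; rewrite !mul1n subnK // in H.
Qed.
(* x^(r-i) y^i *)
Definition sym_mono (i : 'I_r.+1) : Sym := DHomog (sym_mono_dhomog i).

(* Since the translates of the [1, v] span the compact induction, this
   determines T. *)
Definition is_hecke (T : rep_hom (cind_rep Sym) (cind_rep Sym)) : Prop :=
  forall i : 'I_r.+1,
  T (brac (sigma := Sym) 1%g (sym_mono i)) =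
    \sum_(j < p) ract (borel_gl (utri_p1 j))
       (brac (sigma := Sym) 1%g ((- j%:R) ^+ i *: sym_mono ord0))
    + (i == r :> nat)%:R *: ract (borel_gl (utri_1p 1))
       (brac (sigma := Sym) 1%g (sym_mono ord_max)).

End Sym.

Section DetTwist.
Variable chi : qpchar p_pr E.
Definition chi_det (g : B) : E := chi (\det g).
Let chi_det1 : chi_det 1%g = 1.
Proof. by rewrite /chi_det det1 qpchar1. Qed.
Let chi_detM (g h : B) : chi_det (g * h)%g = chi_det g * chi_det h.
Proof.
have det_neq0 (k : B) : \det k != 0 by rewrite -unitfE -unitmxE gl2_unit.
by rewrite /chi_det det_mulmx qpcharM.
Qed.

(* V (x) (chi o det), V being restricted to B *)
Definition res_twist_det (V : rep GL2 E) : rep B E :=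
  twist_rep (res_rep (f := @borel_gl p p_pr) (erefl _) (fun _ _ => erefl _) V)
    chi_det1 chi_detM.
End DetTwist.
End Representations.

(* Main.v *)
(* Write r = h - 1, e_i = x^(r - i) y^i, al = diag(1, p) and u(a) = (1 a ; 0 1).
   By the Iwasawa decomposition, ind Sym^r restricts to the induction of Sym^r from
   KZ to B, so that f |-> (b |-> chi(det b)^-1 f(b) x^r) embeds ind sigma into it,
   B-equivariantly up to the twist by chi o det.  Since T [1, e_r] is [al, e_r] plus
   translates of [1, x^r], the image of ind sigma contains [1, e_r], hence everything,
   modulo the image of T.

   It remains to see that ind sigma meets the image of T in S_2.  If F has the
   coefficients v_c in e_r at the p cosets of h u(-c/p), then T F is, modulo x^r,
   sum_c v_c (y - c x)^r at the coset of h al, and these p cosets are the only ones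
   to contribute.  Therefore T F lies in ind sigma if and only if, for each h, the
   moments sum_c v_c (-c)^s vanish for s < r.  For such v, al T(sum_c v_c [u(-c/p), e_r])
   is the sum of v_c j^r [u(-(c + p j)/p^2), x^r] over c, j < p, plus
   (sum_c v_c (-c)^r) [al^2, x^r], and for i < r the same holds with e_i and j^i in
   place of e_r and j^r, without the last term.

   On the other side, applying u(p^-2) - 1 repeatedly to the generator of S_2 lowers
   the index of w, whence S_2 contains w_{m,2} for all m < h (p - 1).  By Lucas'
   theorem the function 'C(c, t) 'C(j, s) of n = c + p j is 'C(n, t + p s), and the
   two families of relations are matched by expanding v in the 'C(c, t), whose dual
   basis is formed by the functions 'C(p - 1 - c, p - 1 - t). *)

Require Import Defs.
From mathcomp Require Import all_boot all_order all_algebra all_field.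
From mathcomp Require Import all_classical topology.
From mathcomp Require Import -(notations) mpoly.
From mathcomp Require Import zify ring.

Set Implicit Arguments.
Unset Strict Implicit.
Unset Printing Implicit Defensive.
Import Order.TTheory GRing.Theory Num.Theory.
Local Open Scope ring_scope.

(** * Binomial coefficients modulo p *)

Section BinomialsModp.
Variables (R : comNzRingType) (p : nat).
Hypothesis pR : p \in [pchar R].
Let p_pr : prime p := pcharf_prime pR.
Let p_gt0 : (0 < p)%N := prime_gt0 p_pr.

(** This is (1 + X)^p = 1 + X^p read on coefficients: in Vandermonde's convolution ['C(p, i)]
    vanishes in [R] for [0 < i < p]. *)
Lemma bin_addp n m :
  'C(n + p, m)%:R = 'C(n, m)%:R + (if (p <= m)%N then 'C(n, m - p)%:R else 0) :> R.
Proof.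
rewrite addnC -binomial.Vandermonde natr_sum big_ord_recl bin0 mul1n subn0; congr (_ + _).
case: leqP => pm.
  have pm' : (p.-1 < m)%N by rewrite prednK.
  have pE : lift ord0 (Ordinal pm') = p :> nat by rewrite lift0 /= prednK.
  rewrite (bigD1 (Ordinal pm')) // pE binn mul1n.
  rewrite big1 => [|i ip]; first by rewrite /= addr0.
  rewrite lift0 natrM.
  have [lt_ip|le_pi] := ltnP i.+1 p.
    have := prime_dvd_bin p_pr (_ : 0 < i.+1 < p)%N.
    by rewrite lt_ip => /(_ isT); rewrite (dvdn_pcharf pR) => /eqP ->; rewrite mul0r.
  rewrite bin_small ?mul0r // ltn_neqAle le_pi andbT.
  by apply: contraNneq ip => pi; apply/eqP/val_inj; rewrite /= pi.
rewrite big1 // => i _; rewrite lift0 natrM.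
have := prime_dvd_bin p_pr (_ : 0 < i.+1 < p)%N.
rewrite (leq_ltn_trans (ltn_ord i) pm) => /(_ isT).
by rewrite (dvdn_pcharf pR) => /eqP ->; rewrite mul0r.
Qed.

(** Lucas' theorem for the last digit: by [bin_addp], raising [j] by one turns into Pascal's rule
    for ['C(j, s)]. *)
Lemma bin_lucas c a j s : (c < p)%N -> (a < p)%N ->
  'C(c + p * j, a + p * s)%:R = 'C(c, a)%:R * 'C(j, s)%:R :> R.
Proof.
move=> cp ap; elim: j s => [|j IHj] [|s].
- by rewrite !muln0 !addn0 bin0 mulr1.
- rewrite muln0 addn0 bin0n mulr0 bin_small // (leq_trans cp) //.
  by rewrite mulnS addnCA leq_addr.
- by rewrite mulnS addnCA addnC bin_addp IHj muln0 addn0 leqNgt ap !bin0 addr0.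
rewrite mulnS addnCA addnC bin_addp IHj binS natrD mulrDr; congr (_ + _).
have -> : (a + p * s.+1 = a + p * s + p)%N by rewrite mulnS -addnA (addnC p).
by rewrite leq_addl addnK IHj.
Qed.

(** Adding [p ^ 2] raises [n %/ p] by [p], which ['C(_, m %/ p)] does not see since [m %/ p < p].
    This periodicity allows cyclic shifts of sums over [n < p ^ 2]. *)
Lemma bin_addp2 n m : (m < p ^ 2)%N -> 'C(n + p ^ 2, m)%:R = 'C(n, m)%:R :> R.
Proof.
have digits k : k = (k %% p + p * (k %/ p))%N by rewrite mulnC addnC -divn_eq.
rewrite -mulnn => mp; rewrite (digits n) (digits m) -addnA -mulnDr.
rewrite !bin_lucas ?ltn_pmod // bin_addp.
by rewrite leqNgt ltn_divLR // mp addr0.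
Qed.

(* The functions 'C(c, t) and 'C(p - 1 - c, p - 1 - t) of c form dual bases of the
   functions on {0, ..., p - 1}. *)
Lemma bin_dual_col c d : (c < p)%N -> (d < p)%N ->
  \sum_(t < p) 'C(c, t)%:R * 'C(p.-1 - d, p.-1 - t)%:R = (c == d)%:R :> R.
Proof.
move=> cp dp; have dp' : (d <= p.-1)%N by rewrite -ltnS prednK.
transitivity ('C(c + (p.-1 - d), p.-1)%:R : R).
  rewrite -binomial.Vandermonde prednK // natr_sum.
  by apply: eq_bigr => t _; rewrite natrM.
(* The upper index is below [p - 1] if [c < d]; if [c > d] it is [p] plus [c - d - 1 < p - 1], and
   [bin_addp] gives 0 again. *)
case: ltngtP => [cd|dc|->].
- by rewrite bin_small //; lia.
- have -> : (c + (p.-1 - d) = (c - d.+1) + p)%N by lia.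
  rewrite bin_addp leqNgt prednK // leqnn addr0 bin_small //; lia.
- by rewrite subnKC // binn.
Qed.

(** A one-sided inverse of a square matrix is two-sided, so this follows from [bin_dual_col]. *)
Lemma bin_dual_row t u : (t < p)%N -> (u < p)%N ->
  \sum_(c < p) 'C(c, t)%:R * 'C(p.-1 - c, p.-1 - u)%:R = (t == u)%:R :> R.
Proof.
move=> tp up.
pose A : 'M[R]_p := \matrix_(c, t) 'C(c, t)%:R.
pose B : 'M[R]_p := \matrix_(t, c) 'C(p.-1 - c, p.-1 - t)%:R.
have /mulmx1C/matrixP/(_ (Ordinal up) (Ordinal tp)) : A *m B = 1%:M.
  apply/matrixP => c d; rewrite !mxE -(bin_dual_col (ltn_ord c) (ltn_ord d)).
  by apply: eq_bigr => i _; rewrite !mxE.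
rewrite !mxE -val_eqE /= eq_sym => <-.
by apply: eq_bigr => i _; rewrite !mxE mulrC.
Qed.

End BinomialsModp.

(** For [s <= i], [a s] is [s!] times a Stirling number of the second kind. The top value [i!] is
    recorded because it is invertible modulo p for [i < p], so that the triangular change of basis
    can be inverted. *)
Lemma expn_bin i : exists2 a : nat -> nat, a i = i`! &
  forall j, (j ^ i = \sum_(s < i.+1) a s * 'C(j, s))%N.
Proof.
elim: i => [|i [a ai IH]].
  by exists (fun=> 1%N) => // j; rewrite big_ord1 bin0.
(* The test [s == i.+1] discards a value of [a] beyond the range controlled by the induction
   hypothesis. *)
exists (fun s => (if s == i.+1 then 0 else s * a s) + s * (if s is s'.+1 then a s' else 0))%N.
  by rewrite eqxx add0n ai factS.
move=> j; rewrite expnS IH big_distrr /=.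
under [RHS]eq_bigr do rewrite mulnDl.
rewrite big_split /= [X in (_ = X + _)%N]big_ord_recr /= eqxx mul0n addn0.
rewrite [X in (_ = _ + X)%N]big_ord_recl /= !mul0n add0n -big_split /=.
apply: eq_bigr => s _; rewrite /bump /= add1n [s == _ :> nat]ltn_eqF //.
have jC : (j * 'C(j, s) = s * 'C(j, s) + s.+1 * 'C(j, s.+1))%N.
  rewrite mul_bin_left -mulnDl; case: (leqP s j) => [/subnKC -> //|sj].
  by rewrite bin_small // !muln0.
by rewrite mulnCA jC add0n; ring.
Qed.

Lemma big_ord_mul (V : nmodType) m n (G : nat -> V) :
  \sum_(i < m * n) G i = \sum_(c < m) \sum_(j < n) G (c + m * j)%N.
Proof.
elim: n => [|n IHn].
  by rewrite muln0 big_ord0 big1 // => c _; rewrite big_ord0.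
under [RHS]eq_bigr do rewrite big_ord_recr.
rewrite big_split /= -IHn mulnS addnC big_split_ord /=; congr (_ + _).
by apply: eq_bigr => c _; rewrite addnC.
Qed.

(** * Sums weighted by functions of the two base p digits *)

Section BinomialSums.
Variables (F : fieldType) (p : nat).
Hypothesis pF : p \in [pchar F].
Variables (V : lmodType F) (S : submodClosed V) (z : nat -> V) (y : V) (r : nat).
Hypothesis r_lt : (r < p.-1)%N.
Let p_pr : prime p := pcharf_prime pF.
Let p_gt0 : (0 < p)%N := prime_gt0 p_pr.

(** When [z n] is the bracket of (1 -n/p^2 ; 0 1), this is w_{m,2}. The bipower sums are what the
    Hecke operator produces; the bibinomial sums mediate between the two. *)
Definition bin_sum m := \sum_(n < p ^ 2) 'C(n, m)%:R *: z n.
Definition bipower_sum (v : nat -> F) i :=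
  \sum_(c < p) \sum_(j < p) (v c * j%:R ^+ i) *: z (c + p * j)%N.
Definition bibin_sum (v : nat -> F) i :=
  \sum_(c < p) \sum_(j < p) (v c * 'C(j, i)%:R) *: z (c + p * j)%N.
Definition moment (v : nat -> F) s := \sum_(c < p) v c * (- c%:R) ^+ s.
(** By [bin_dual_col], the coordinate of [v] at ['C(c, t)] is the dual moment of index
    [p - 1 - t]. *)
Definition dual_moment (v : nat -> F) s := \sum_(c < p) v c * 'C(p.-1 - c, s)%:R.

(* In base p, [h * (p - 1)] for [h = r + 1] has the digits [p - 1 - r] and [r]. *)
Let l := (r.+1 * p.-1)%N.

Lemma fact_neq0 i : (i < p)%N -> i`!%:R != 0 :> F.
Proof.
elim: i => [|i IHi] ip; first by rewrite oner_eq0.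
rewrite factS natrM mulf_neq0 ?IHi ?(ltnW ip) //.
rewrite -(dvdn_pcharf pF); apply/negP => /(dvdn_leq (ltn0Sn i)).
by rewrite leqNgt ip.
Qed.

Lemma bipower_bibin (i : nat) : exists2 a : nat -> F, a i = i`!%:R &
  forall v, bipower_sum v i = \sum_(s < i.+1) a s *: bibin_sum v s.
Proof.
have [a ai aE] := expn_bin i; exists (fun s => (a s)%:R); first by rewrite ai.
move=> v; under [RHS]eq_bigr do rewrite scaler_sumr.
rewrite exchange_big; apply: eq_bigr => c _ /=.
under [RHS]eq_bigr do rewrite scaler_sumr.
rewrite exchange_big; apply: eq_bigr => j _ /=.
rewrite -natrX aE natr_sum mulr_sumr scaler_suml; apply: eq_bigr => s _.
by rewrite scalerA natrM mulrCA.
Qed.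

(** Modulo p, [p - 1 - c] is [-1 - c]. Pair [v] with its s-th power: expanded in powers of [-c],
    only the moment of index [s] survives; expanded in binomials, only the dual moment of index [s]
    does, with factor [s!]. *)
Lemma dual_moment_moment v s : (s < p)%N -> (forall i, (i < s)%N -> moment v i = 0) ->
  moment v s = s`!%:R * dual_moment v s.
Proof.
elim/ltn_ind: s => s IHs sp mv.
have [a as_ aE] := expn_bin s.
transitivity (\sum_(i < s.+1) (a i)%:R * dual_moment v i).
  transitivity (\sum_(c < p) v c * (p.-1 - c)%:R ^+ s).
    transitivity (\sum_(i < s.+1) moment v i * ((-1) ^+ (s - i) *+ 'C(s, i))).
      rewrite big_ord_recr /= subnn binn mulr1 big1 ?add0r // => i _.
      by rewrite mv ?mul0r.
    under eq_bigr do rewrite mulr_suml.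
    rewrite exchange_big; apply: eq_bigr => c _ /=.
    have -> : (p.-1 - c)%:R = -1 - c%:R :> F.
      have cp : (c <= p.-1)%N by rewrite -ltnS prednK.
      rewrite natrB // -subn1 natrB // (pcharf0 pF); ring.
    rewrite exprDn mulr_sumr; apply: eq_bigr => i _.
    by rewrite -mulrA mulrnAr [(- c%:R) ^+ _ * _]mulrC.
  under [RHS]eq_bigr do rewrite mulr_sumr.
  rewrite exchange_big; apply: eq_bigr => c _ /=.
  rewrite -natrX aE natr_sum mulr_sumr; apply: eq_bigr => i _.
  by rewrite natrM mulrCA.
rewrite big_ord_recr /= as_ big1 ?add0r // => i _.
have /esym/eqP := mv _ (ltn_ord i).
rewrite IHs ?(ltn_trans _ sp) // => [|k ki]; last exact: mv (ltn_trans ki _).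
by rewrite eq_sym mulf_eq0 (negPf (fact_neq0 (ltn_trans (ltn_ord i) sp))) => /eqP ->; rewrite mulr0.
Qed.

Lemma dual_moment_eq0 v k : (k <= p)%N -> (forall s, (s < k)%N -> moment v s = 0) ->
  forall s, (s < k)%N -> dual_moment v s = 0.
Proof.
move=> kp mv s sk; have sp := leq_trans sk kp.
have /esym/eqP := mv _ sk; rewrite dual_moment_moment // => [|i si]; last first.
  exact: mv (ltn_trans si sk).
by rewrite eq_sym mulf_eq0 (negPf (fact_neq0 sp)) => /eqP.
Qed.

Let memDl (a b : V) : a + b \in S -> a \in S -> b \in S.
Proof.
move=> abS aS; have -> : b = (-1) *: a + (a + b) by rewrite scaleN1r addKr.
by rewrite rpredD // rpredZ.
Qed.

Let lt_l t s : (t < p)%N -> (s < r)%N -> (t + p * s < l)%N.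
Proof. by move=> tp sr; rewrite /l; nia. Qed.
Let lE : l = (p.-1 - r + p * r)%N.
Proof. by rewrite /l; nia. Qed.

Lemma bin_sumE m : bin_sum m =
  \sum_(c < p) \sum_(j < p) 'C(c + p * j, m)%:R *: z (c + p * j)%N.
Proof.
by rewrite -(big_ord_mul p p (fun n => 'C(n, m)%:R *: z n)) mulnn.
Qed.

(** Expand [v] in the ['C(c, t)]; Lucas' theorem then merges ['C(c, t) * 'C(j, i)] into one binomial
    of [c + p * j]. *)
Lemma bibin_sum_dual v i :
  bibin_sum v i = \sum_(t < p) dual_moment v (p.-1 - t) *: bin_sum (t + p * i).
Proof.
under [RHS]eq_bigr do rewrite bin_sumE scaler_sumr.
rewrite exchange_big; apply: eq_bigr => c _ /=.
under [RHS]eq_bigr do rewrite scaler_sumr.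
rewrite exchange_big; apply: eq_bigr => j _ /=.
transitivity ((\sum_(t < p) dual_moment v (p.-1 - t) * 'C(c, t)%:R * 'C(j, i)%:R)
              *: z (c + p * j)%N).
  congr (_ *: _); rewrite -mulr_suml; congr (_ * _).
  under eq_bigr do rewrite mulr_suml.
  rewrite exchange_big (bigD1 c) //= -[LHS]addr0; congr (_ + _).
    under eq_bigr do rewrite mulrAC -mulrA.
    by rewrite -mulr_sumr (bin_dual_col pF) // eqxx mulr1.
  rewrite big1 // => d dc.
  under eq_bigr do rewrite mulrAC -mulrA.
  by rewrite -mulr_sumr (bin_dual_col pF) // val_eqE eq_sym (negPf dc) mulr0.
rewrite scaler_suml; apply: eq_bigr => t _.
by rewrite scalerA (bin_lucas pF) // mulrA.
Qed.

Lemma bin_sum_bibin (t s : nat) : (t < p)%N ->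
  bin_sum (t + p * s) = bibin_sum (fun c => 'C(c, t)%:R) s.
Proof.
move=> tp; rewrite bin_sumE; apply: eq_bigr => c _.
by apply: eq_bigr => j _; rewrite (bin_lucas pF).
Qed.

Lemma bibin_sum_mem v i : (forall m, (m < l)%N -> bin_sum m \in S) ->
  (i < r)%N -> bibin_sum v i \in S.
Proof.
move=> zS ir; rewrite bibin_sum_dual rpred_sum // => t _.
by rewrite rpredZ // zS // lt_l.
Qed.

Lemma bipower_sum_mem v i : (forall m, (m < l)%N -> bin_sum m \in S) ->
  (i < r)%N -> bipower_sum v i \in S.
Proof.
move=> zS ir; have [a _ ->] := bipower_bibin i.
rewrite rpred_sum // => s _; rewrite rpredZ // bibin_sum_mem //.
by rewrite (leq_trans (ltn_ord s)).
Qed.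

(** In the expansion of [bibin_sum v r], the terms with [t < p - 1 - r] have index below [l], those
    with [t > p - 1 - r] have zero dual moment, and [t = p - 1 - r] gives [bin_sum l]. The factor
    [r!] turns the dual moment into [moment v r]. *)
Lemma bipower_sum_top v : (forall s, (s < r)%N -> moment v s = 0) ->
    (forall m, (m < l)%N -> bin_sum m \in S) ->
  exists2 x, x \in S &
    moment v r *: y + bipower_sum v r = moment v r *: (y + bin_sum l) + x.
Proof.
move=> mv zS; have rp : (r < p)%N by rewrite (leq_trans r_lt) // leq_pred.
have mvr := dual_moment_moment rp mv.
have [a ar ->] := bipower_bibin r; rewrite big_ord_recr /= ar.
set x := \sum_(i < r) _.
have xS : x \in S by rewrite rpred_sum // => s _; rewrite rpredZ // bibin_sum_mem.
rewrite bibin_sum_dual.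
have rp' : (p.-1 - r < p)%N by rewrite -[X in (_ < X)%N](prednK p_gt0) ltnS leq_subr.
rewrite (bigD1 (Ordinal rp')) //= subKn ?(ltnW r_lt) // -lE scalerDr scalerA -mvr.
set x' := _ *: \sum_(i < p | _) _.
exists (x + x'); last by rewrite scalerDr (addrCA x) !addrA.
rewrite rpredD // rpredZ // rpred_sum // => t tr.
have [tr'|tr'] := ltnP t (p.-1 - r).
  by rewrite rpredZ // zS // lE ltn_add2r.
rewrite (dual_moment_eq0 (ltnW rp)) //; last first.
  have : t != (p.-1 - r)%N :> nat by apply: contraNneq tr => tr; apply/eqP/val_inj.
  have := ltn_ord t; lia.
by rewrite scale0r rpred0.
Qed.

(** Partial converse of the two preceding lemmas, used to show that the generator of S_2 maps into
    the image of T. *)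
Lemma bin_sum_top_mem :
    (forall v i, (i < r)%N -> bipower_sum v i \in S) ->
    (forall v, (forall s, (s < r)%N -> moment v s = 0) ->
       moment v r *: y + bipower_sum v r \in S) ->
  y + bin_sum l \in S.
Proof.
move=> bS tS; have rp : (r < p)%N by rewrite (leq_trans r_lt) // leq_pred.
have bbS v i : (i < r)%N -> bibin_sum v i \in S.
  elim/ltn_ind: i => i IHi ir; have [a ai aE] := bipower_bibin i.
  have := bS v i ir; rewrite aE big_ord_recr /= ai => /memDl H.
  have /H : \sum_(s < i) a s *: bibin_sum v s \in S.
    by rewrite rpred_sum // => s _; rewrite rpredZ // IHi // (ltn_trans _ ir).
  move/(rpredZ (i`!%:R^-1)); rewrite scalerA mulVf ?scale1r //.
  by rewrite fact_neq0 // (ltn_trans ir).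
(* With these weights the bibinomial sum of index [r] is [bin_sum l] itself, and by [bin_dual_row]
   the first nonzero dual moment is that of index [r], equal to 1. *)
pose v c : F := 'C(c, p.-1 - r)%:R.
have rp' : (p.-1 - r < p)%N by lia.
have dv s : (s <= r)%N -> dual_moment v s = (s == r)%:R.
  move=> sr; have {1}-> : s = (p.-1 - (p.-1 - s))%N by lia.
  rewrite /dual_moment (bin_dual_row pF) //; last by lia.
  congr (_%:R); apply/eqP/eqP; lia.
have mv s : (s < r)%N -> moment v s = 0.
  elim/ltn_ind: s => s IHs sr; rewrite dual_moment_moment ?(ltn_trans sr) //.
    by rewrite dv ?(ltnW sr) // ltn_eqF // mulr0.
  by move=> i si; rewrite IHs // (ltn_trans si).
have := tS v mv; have [a ar ->] := bipower_bibin r.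
rewrite big_ord_recr /= ar addrCA => /memDl H.
have /H : \sum_(s < r) a s *: bibin_sum v s \in S.
  by rewrite rpred_sum // => s _; rewrite rpredZ // bbS.
rewrite dual_moment_moment // dv // eqxx mulr1 -bin_sum_bibin // -lE -scalerDr.
by move/(rpredZ (r`!%:R^-1)); rewrite scalerA mulVf ?scale1r ?fact_neq0.
Qed.

End BinomialSums.

(** * Compact induction *)

Lemma ractZ (G : groupType) (F : fieldType) (V : rep G F) g (a : F) (v : V) :
  ract g (a *: v) = a *: ract g v.
Proof.
by rewrite -[a *: v]addr0 ract_linear (lin_fun0 (@ract_linear _ _ V g)) addr0.
Qed.

Lemma ractD (G : groupType) (F : fieldType) (V : rep G F) g (u v : V) :
  ract g (u + v) = ract g u + ract g v.
Proof. by rewrite -[u]scale1r ract_linear !scale1r. Qed.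

Lemma ract_sum (G : groupType) (F : fieldType) (V : rep G F) g I
    (s : seq I) (P : pred I) (f : I -> V) :
  ract g (\sum_(i <- s | P i) f i) = \sum_(i <- s | P i) ract g (f i).
Proof.
apply: (big_morph (ract g)) => [u v|]; first exact: ractD.
exact: lin_fun0 (@ract_linear _ _ V g).
Qed.

Section RepHom.
Variables (G : groupType) (F : fieldType) (V W : rep G F) (T : rep_hom V W).

Lemma rhom0 : T 0 = 0.
Proof. exact: lin_fun0 (rhom_linear T). Qed.

Lemma rhomZ a (v : V) : T (a *: v) = a *: T v.
Proof. by rewrite -[a *: v]addr0 (rhom_linear T) rhom0 addr0. Qed.

Lemma rhomD (u v : V) : T (u + v) = T u + T v.
Proof. by rewrite -[u]scale1r (rhom_linear T) !scale1r. Qed.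

Lemma rhom_sum J (s : seq J) (P : pred J) (f : J -> V) :
  T (\sum_(i <- s | P i) f i) = \sum_(i <- s | P i) T (f i).
Proof. by apply: (big_morph (rhom T)) => [u v|]; [exact: rhomD | exact: rhom0]. Qed.

End RepHom.

(** * Brackets and their span *)

Section Brackets.
Local Open Scope classical_set_scope.
Variables (G : rtopGroupType) (KZ : KZpair G) (F : fieldType).
Variable sigma : KZrep KZ F.
Local Notation H := (KZset KZ).
Local Notation ind := (cind_rep sigma).
Let HM g h : H g -> H h -> H (g * h)%g.
Proof. by case: (@KZ_subgroup G KZ) => _ + _; apply. Qed.
Let HV g : H g -> H g^-1%g.
Proof. by case: (@KZ_subgroup G KZ) => _ _; apply. Qed.

Lemma kzact0 k : kzact k 0 = 0 :> sigma.
Proof. exact: lin_fun0 (@kzact_linear _ _ _ sigma k). Qed.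

Lemma kzactZ k a (v : sigma) : kzact k (a *: v) = a *: kzact k v.
Proof. by rewrite -[a *: v]addr0 kzact_linear kzact0 addr0. Qed.

Lemma cind_eqP (f g : ind) : (forall x, f x = g x) -> f = g.
Proof. by move=> fg; apply: val_inj; apply/funext. Qed.

Lemma cind_addE (f g : ind) x : (f + g) x = f x + g x. Proof. by []. Qed.
Lemma cind_scaleE a (f : ind) x : (a *: f) x = a *: f x. Proof. by []. Qed.
Lemma cind_ractE g (f : ind) x : (ract g f : ind) x = f (x * g)%g. Proof. by []. Qed.
Lemma cind_0E x : (0 : ind) x = 0. Proof. by []. Qed.
Lemma cind_sumE I (s : seq I) (P : pred I) (f : I -> ind) x :
  (\sum_(i <- s | P i) f i) x = \sum_(i <- s | P i) f i x.
Proof. exact: (big_morph (fun f : ind => f x)). Qed.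
Lemma cind_equiv (f : ind) k g : H k -> f (k * g)%g = kzact k (f g).
Proof. by have [fE _] := asboolP _ (cindP f); apply: fE. Qed.

Lemma ract_brac g h v : ract g (brac h v) = brac (g * h)%g v :> ind.
Proof. by apply: cind_eqP => x; rewrite /= /brac_fun mulgA. Qed.

Lemma brac_in g v x : H (x * g)%g -> brac (sigma := sigma) g v x = kzact (x * g)%g v.
Proof. by move=> Hx; rewrite /= /brac_fun asboolT. Qed.

Lemma brac_out g v x : ~ H (x * g)%g -> brac (sigma := sigma) g v x = 0.
Proof. by move=> Hx; rewrite /= /brac_fun asboolF. Qed.

Lemma brac_mulr g k v : H k -> brac (sigma := sigma) (g * k)%g v = brac g (kzact k v).
Proof.
move=> Hk; apply: cind_eqP => x; have [Hx|Hx] := pselect (H (x * g)%g).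
  by rewrite brac_in ?mulgA ?brac_in ?[kzact (_ * k)%g _]kzactM //; apply: HM.
rewrite !brac_out // => Hx'; apply: Hx.
by rewrite -(mulgK k (x * g)%g) -[(x * g * k)%g]mulgA; apply: HM => //; apply: HV.
Qed.

Lemma brac_linear g a u v :
  brac (sigma := sigma) g (a *: u + v) = (a *: brac g u + brac g v : ind).
Proof.
apply: cind_eqP => x; rewrite cind_addE cind_scaleE.
have [Hx|Hx] := pselect (H (x * g)%g); first by rewrite !brac_in // kzact_linear.
by rewrite !brac_out // scaler0 addr0.
Qed.

Lemma brac0 g : brac (sigma := sigma) g 0 = 0.
Proof. exact: lin_fun0 (brac_linear g). Qed.
Lemma bracZ g a v : brac (sigma := sigma) g (a *: v) = (a *: brac g v : ind).
Proof. by rewrite -[a *: v]addr0 brac_linear brac0 addr0. Qed.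
Lemma bracD g u v : brac (sigma := sigma) g (u + v) = (brac g u + brac g v : ind).
Proof. by rewrite -[u]scale1r brac_linear !scale1r. Qed.
Lemma brac_sum g I (s : seq I) (P : pred I) (f : I -> sigma) :
  brac g (\sum_(i <- s | P i) f i) = \sum_(i <- s | P i) brac g (f i) :> ind.
Proof. by apply: (big_morph (fun v => brac g v : ind)) => [u v|]; rewrite ?bracD ?brac0. Qed.

Hypothesis H_nbhs : nbhs (1%g : G) H.

(** As [H] is a neighbourhood of 1, its right cosets contain neighbourhoods of their points;
    finitely many of them cover a compact set. *)
Lemma cind_cover (f : ind) :
  exists L : seq G, forall g, f g <> 0 -> exists2 b, b \in L & H (g * b^-1)%g.
Proof.
have [_ [C Cc fC]] := asboolP _ (cindP f).
pose U (b : G) := [set g : G | H (g * b^-1)%g].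
have bU b : nbhs b (U b).
  have Hb : nbhs (b * b^-1)%g H by rewrite mulgV.
  exact: (@mulg_continuous G b^-1%g b _ Hb).
(* The lists ordered by inclusion form a filter, for which the near-covering form of compactness
   yields a finite subcover. *)
pose sups (L : seq G) := [set L' : seq G | {subset L <= L'}].
pose Fin := filter_from [set: seq G] sups.
have FinF : Filter Fin.
  apply: filter_from_filter => [|L L' _ _]; first by exists [::].
  by exists (L ++ L') => // M LM; split=> x xL; apply: LM; rewrite mem_cat xL ?orbT.
have /compact_near_coveringP/(_ _ Fin (fun L x => exists2 b, b \in L & U b x) FinF) := Cc.
case=> [b Cb|L _ /(_ L)/(_ (fun _ => id)) CL].
  exists (U b, sups [:: b]); first by split=> //; exists [:: b].
  by move=> [x L] [/= Ubx bL]; exists b => //; apply: bL; rewrite inE.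
exists L => g /fC[z Zz [c /CL[b bL Ucb] ->]].
exists b => //; rewrite -mulgA; rewrite (KZ_Z_central _ Zz).
have [k Kk [z' Zz' ->]] := Ucb; exists k => //; exists (z' * z)%g; last by rewrite mulgA.
by case: (KZ_Z_group KZ) => _ ZM _; apply: ZM.
Qed.

(** Subtracting [brac b^-1 (f b)] kills [f] on the coset [H b] and leaves it unchanged elsewhere, so
    the covering list gets shorter. *)
Lemma cind_ind (P : ind -> Prop) : P 0 ->
  (forall g v f, P f -> P (brac g v + f)) -> forall f, P f.
Proof.
move=> P0 PD f; have [L] := cind_cover f.
elim: L f => [|b L IHL] f fL.
  suff -> : f = 0 by [].
  by apply: cind_eqP => g; apply: contrapT => /fL[].
rewrite -[f](subrKC (brac b^-1%g (f b))); apply: PD; apply: IHL => g fg.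
have bH : H (g * b^-1)%g -> (f - brac b^-1%g (f b)) g = 0.
  move=> Hg; rewrite -scaleN1r cind_addE cind_scaleE brac_in //.
  by rewrite -cind_equiv // mulgVK scaleN1r subrr.
have {bH} nH : ~ H (g * b^-1)%g by move/bH.
have : f g <> 0.
  by move=> fg0; apply: fg; rewrite -scaleN1r cind_addE cind_scaleE brac_out // fg0 scaler0 addr0.
by move=> /fL[c]; rewrite inE => /predU1P[->//|cL Hc]; exists c.
Qed.

End Brackets.

(** * Homogeneous polynomials in two variables *)

Lemma coef_affine_exp (R : comNzRingType) (a b : R) n s :
  ((a%:P + b%:P * 'X) ^+ n)`_s = 'C(n, s)%:R * a ^+ (n - s) * b ^+ s.
Proof.
rewrite exprDn coef_sum.
under eq_bigr => i _.
  rewrite exprMn -!rmorphXn mulrA -rmorphM coefMn coefCM coefXn /= mulr_natr.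
  over.
have [sn|ns] := ltnP s n.+1; last first.
  rewrite bin_small // !mul0r big1 // => i _.
  by rewrite gtn_eqF ?mulr0n ?mul0rn // (leq_trans (ltn_ord i)).
rewrite (bigD1 (Ordinal sn)) //= eqxx mulr1n big1 ?addr0 => [|i is'].
  by rewrite -mulrA [RHS]mulrC mulr_natr.
rewrite [s == _](_ : _ = false) ?mulr0n ?mul0rn //.
by apply: contraNF is' => /eqP si; apply/eqP/val_inj.
Qed.

Section SymBasis.
Variables (p : nat) (p_pr : prime p) (E : fieldExtType 'F_p) (r : nat).
Local Notation Sym := (Sym p_pr E r).
Local Notation X i := (mpolyX E (mnm1 i) : mpoly 2 E).
Local Notation mono := (@sym_mono p p_pr E r).

(** Setting x = 1 and y = X makes the coefficient of x^(r - s) y^s an ordinary coefficient of a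
    polynomial in one variable. *)
Definition dehom (P : mpoly 2 E) : {poly E} :=
  mmap (@polyC E) (fun i : 'I_2 => if i == 0 then 1 else 'X) P.
Let dehomD (P Q : mpoly 2 E) : dehom (P + Q) = dehom P + dehom Q.
Proof. exact: raddfD. Qed.
Let dehomM (P Q : mpoly 2 E) : dehom (P * Q) = dehom P * dehom Q.
Proof. exact: rmorphM. Qed.
Let dehomZ a (P : mpoly 2 E) : dehom (a *: P) = a *: dehom P.
Proof. by rewrite /dehom mmapZ mul_polyC. Qed.
Let dehom1 : dehom 1 = 1.
Proof. exact: rmorph1. Qed.
Let dehomXn (P : mpoly 2 E) n : dehom (P ^+ n) = dehom P ^+ n.
Proof. by elim: n => [|n IHn]; rewrite ?dehom1 // !exprS dehomM IHn. Qed.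
Let dehomX i : dehom (X i) = if i == 0 then 1 else 'X.
Proof. by rewrite /dehom mmapX mmap1U. Qed.

Definition sym_coef (P : Sym) (s : nat) : E :=
  (dehom (mpoly_of_dhomog (P : dhomog 2 E r)))`_s.

Lemma sym_coef_linear a (P Q : Sym) s :
  sym_coef (a *: P + Q) s = a * sym_coef P s + sym_coef Q s.
Proof. by rewrite /sym_coef /= dehomD dehomZ coefD coefZ. Qed.
Lemma sym_coef0 s : sym_coef 0 s = 0.
Proof. by rewrite /sym_coef /= /dehom raddf0 coef0. Qed.
Lemma sym_coefZ a P s : sym_coef (a *: P) s = a * sym_coef P s.
Proof. by rewrite -[a *: P]addr0 sym_coef_linear sym_coef0 addr0. Qed.
Lemma sym_coefD P Q s : sym_coef (P + Q) s = sym_coef P s + sym_coef Q s.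
Proof. by rewrite -[P]scale1r sym_coef_linear mul1r scale1r. Qed.
Lemma sym_coef_sum I (t : seq I) (T : pred I) (f : I -> Sym) s :
  sym_coef (\sum_(i <- t | T i) f i) s = \sum_(i <- t | T i) sym_coef (f i) s.
Proof. by apply: (big_morph (fun P => sym_coef P s)) => [P Q|]; rewrite ?sym_coefD ?sym_coef0. Qed.

Lemma sym_coef_mono (i : 'I_r.+1) s : sym_coef (mono i) s = (i == s :> nat)%:R.
Proof. by rewrite /sym_coef /= dehomM !dehomXn !dehomX /= expr1n mul1r coefXn eq_sym. Qed.

Lemma sym_expand (P : Sym) : P = \sum_(i < r.+1) sym_coef P i *: mono i.
Proof.
(* In degree [r] a monomial is determined by its exponent of y, by which the support is grouped;
   [sym_coef] then recovers [c]. *)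
have [c ->] : exists c : 'I_r.+1 -> E, P = \sum_(i < r.+1) c i *: mono i.
  pose Q := mpoly_of_dhomog (P : dhomog 2 E r).
  exists (fun i => \sum_(m <- msupp Q | m (1 : 'I_2) == i :> nat) mcoeff m Q).
  under eq_bigr do rewrite scaler_suml.
  rewrite (exchange_big_dep xpredT) //=; apply: val_inj.
  rewrite [LHS](mpolyE Q) [RHS]raddf_sum; rewrite [LHS]big_seq [RHS]big_seq.
  apply: eq_bigr => m mQ.
  have mr : mdeg m = r by have /dhomogP/(_ m mQ) := dhomog_is_dhomog P.
  move: mr; rewrite mdegE 2!big_ord_recl big_ord0 addn0 => mr.
  have l1 : lift ord0 ord0 = (1 : 'I_2) by apply: val_inj.
  rewrite l1 in mr; have m1r : (m (1 : 'I_2)%R < r.+1)%N by rewrite ltnS -mr leq_addl.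
  rewrite (big_pred1 (Ordinal m1r)) => [|i]; last by rewrite /= -val_eqE eq_sym.
  rewrite /=; congr (_ *: _); rewrite mpolyXE_id 2!big_ord_recl big_ord0 mulr1.
  by rewrite l1 -mr addnK.
apply: eq_bigr => i _; congr (_ *: _).
rewrite sym_coef_sum (bigD1 i) //= sym_coefZ sym_coef_mono eqxx mulr1 big1 ?addr0 // => j ji.
by rewrite sym_coefZ sym_coef_mono val_eqE (negPf ji) mulr0.
Qed.

Lemma sym_coef_eq (P Q : Sym) :
  (forall s, (s <= r)%N -> sym_coef P s = sym_coef Q s) -> P = Q.
Proof.
move=> PQ; rewrite (sym_expand P) (sym_expand Q); apply: eq_bigr => i _.
by rewrite PQ // -ltnS.
Qed.

(* For an upper triangular [k], [lin_act k] sends [x^(r - i) y^i] to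
   [(k00 x)^(r - i) (k01 x + k11 y)^i]. *)
Lemma sym_coef_lin_act (k : 'M[E]_2) (i : 'I_r.+1) s : k 1 0 = 0 ->
  sym_coef (lin_act k (mono i)) s =
    k 0 0 ^+ (r - i) * ('C(i, s)%:R * k 0 1 ^+ (i - s) * k 1 1 ^+ s).
Proof.
have subX (j : 'I_2) : comp_mpoly (lin_subst k) (X j) = \sum_(i0 < 2) k i0 j *: X i0.
  by rewrite comp_mpolyXU -tnth_nth tnth_mktuple.
move=> k10; rewrite /sym_coef /= rmorphM !rmorphXn /= !subX dehomM !dehomXn.
rewrite !big_ord_recl !big_ord0 /=.
have -> : lift ord0 ord0 = 1 :> 'I_2 by apply: val_inj.
rewrite k10 !addr0 scale0r addr0 dehomD !dehomZ !dehomX /=.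
rewrite exprZn expr1n -scalerAl mul1r coefZ; congr (_ * _).
by rewrite -coef_affine_exp alg_polyC mul_polyC.
Qed.
End SymBasis.

(** * The Iwasawa decomposition *)

Section KZ.
Variables (p : nat) (p_pr : prime p).
Local Notation Zp := (padic_int p_pr).
Local Notation Qp := (padic p_pr).
Local Notation GL2 := (GL2 p_pr).
Local Notation B := (borel p_pr).
Local Notation KG := (GL2_KZ p_pr).
Local Notation KB := (borel_KZ p_pr).
Implicit Types (g : GL2) (b : B) (k : 'M[Zp]_2).

Let padic_res_unit (x : Zp) : padic_res x != 0 -> x \is a GRing.unit.
Proof. by move=> xr; apply/padic_unitP => x1; move: xr; rewrite /padic_res x1 eqxx. Qed.

Let int_mx_unit k : k \in unitmx -> padic_of_int_mx k \in unitmx.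
Proof. by rewrite !unitmxE det_map_mx => /rmorph_unit; apply. Qed.

Lemma KZ_mem g k (m : int) : k \in unitmx ->
  gl2_mx g = p%:R ^ m *: padic_of_int_mx k -> KZset KG g.
Proof.
move=> ku gE; exists (MkGL2 (int_mx_unit ku)); first by exists k.
have zu : (p%:R ^ m)%:M \in @unitmx Qp 2.
  by rewrite unitmxE det_scalar unitrX // unitfE expfz_neq0 ?padic_p_neq0.
exists (MkGL2 zu); first by exists (p%:R ^ m).
by apply: val_inj; rewrite /= gE mul_mx_scalar.
Qed.

(** A matrix congruent to 1 modulo p has a determinant that reduces to 1, hence is unimodular. *)
Lemma KZ_GL2_nbhs : nbhs (1%g : GL2) (KZset KG).
Proof.
have H : nbhs (gl2_mx (1%g : GL2)) (@intunitmx p p_pr 2).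
  apply/nbhs_padic_mx; exists 1 => N; exists (1%:M + p%:R *: N).
    rewrite unitmxE padic_res_unit // -det_map_mx map_mxD map_mxZ map_mx1.
    by rewrite rmorph_nat pchar_Fp_0 // scale0r addr0 det1 oner_eq0.
  by rewrite /padic_of_int_mx map_mxD map_mx1 map_mxZ rmorph_nat expr1.
have : nbhs (1%g : GL2) (gl2_mx (p_pr := p_pr) @^-1` @intunitmx p p_pr 2)%classic.
  exact: (@initial_continuous GL2 _ (@gl2_mx p p_pr) 1%g _ H).
apply: filterS => g gI; exists g => //.
by exists 1%g; rewrite ?mulg1 //; exists 1.
Qed.

(** Scalars are upper triangular, so if [b = k * z] then [k] lies in the Borel subgroup as well. *)
Lemma KZ_borelE b : KZset KB b <-> KZset KG (borel_gl b).
Proof.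
split=> [[k Kk [z Zz ->]]|[k Kk [z [a za] bE]]].
  by exists (borel_gl k) => //; exists (borel_gl z).
have z10 : z 1 0 == 0 by rewrite za !mxE.
exists (b * (MkBorel z10)^-1)%g; last first.
  by exists (MkBorel z10); [exists a|rewrite mulgVK].
by rewrite /= bE [X in (GL2Zp X)](_ : _ = k) //= mulgK.
Qed.

Lemma KZ_borel_nbhs : nbhs (1%g : B) (KZset KB).
Proof.
have H : nbhs (borel_mx (1%g : B)) (@intunitmx p p_pr 2).
  apply/nbhs_padic_mx; exists 1 => N; exists (1%:M + p%:R *: N).
    rewrite unitmxE padic_res_unit // -det_map_mx map_mxD map_mxZ map_mx1.
    by rewrite rmorph_nat pchar_Fp_0 // scale0r addr0 det1 oner_eq0.
  by rewrite /padic_of_int_mx map_mxD map_mx1 map_mxZ rmorph_nat expr1.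
have : nbhs (1%g : B) (borel_mx (p_pr := p_pr) @^-1` @intunitmx p p_pr 2)%classic.
  exact: (@initial_continuous B _ (@borel_mx p p_pr) 1%g _ H).
apply: filterS => g gI; exists g => //.
by exists 1%g; rewrite ?mulg1 //; exists 1.
Qed.

Lemma det_mx2 (R : comPzRingType) (k : 'M[R]_2) :
  \det k = k 0 0 * k 1 1 - k 0 1 * k 1 0.
Proof.
have l1 : lift ord0 ord0 = (1 : 'I_2) by apply: val_inj.
have l0 : lift (1 : 'I_2) 0 = 0 by apply: val_inj.
rewrite (expand_det_row _ 0) !big_ord_recl big_ord0 addr0 /cofactor.
by rewrite !det_mx11 !mxE /= !l1 l0 expr0 expr1 mul1r mulN1r mulrN.
Qed.

Lemma mx2_unit (R : comUnitRingType) (k : 'M[R]_2) :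
  k 0 0 * k 1 1 - k 0 1 * k 1 0 \is a GRing.unit -> k \in unitmx.
Proof. by rewrite unitmxE det_mx2. Qed.

Lemma padic_int_or_inv (x : Qp) :
  (exists t : Zp, x = padic_of_int t) \/ (exists t : Zp, x^-1 = padic_of_int t).
Proof.
have [->|/padic_factor[m [u uu ->]]] := eqVneq x 0.
  by left; exists 0; rewrite rmorph0.
case: m => n.
  by left; exists (p%:R ^+ n * u); rewrite rmorphM rmorphXn /= rmorph_nat.
right; exists (p%:R ^+ n.+1 * u^-1); rewrite NegzE -exprnN invfM invrK.
by rewrite rmorphM rmorphXn /= rmorph_nat rmorphV.
Qed.

(** An integral row operation clears the lower left entry: one of the two ratios of the entries of
    the first column is integral, with a swap of rows when it is [g 0 0 / g 1 0]. *)
Lemma iwasawa g : exists h b, KZset KG h /\ g = (h * borel_gl b)%g.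
Proof.
suff [k ku k10] : exists2 k, k \in unitmx & (padic_of_int_mx k *m g) 1 0 == 0.
  pose h := MkGL2 (int_mx_unit ku).
  exists h^-1%g, (@MkBorel _ _ (h * g)%g k10); split; last by rewrite /= mulKg.
  apply: (@KZ_mem _ (invmx k) 0); first by rewrite unitmx_inv.
  rewrite expr0z scale1r /=; apply: (can_inj (mulKmx (int_mx_unit ku))).
  by rewrite mulmxV ?int_mx_unit // -map_mxM mulmxV // map_mx1.
have [g0|g0] := eqVneq (g 0 0) 0.
  exists (\matrix_(i, j) (i != j)%:R).
    by apply: mx2_unit; rewrite !mxE /= mul0r mul1r add0r unitrN unitr1.
  by rewrite mulmx2E !mxE /= rmorph1 rmorph0 g0 mulr0 mul0r addr0.
have [[t tE]|[t tE]] := padic_int_or_inv (g 1 0 / g 0 0).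
  exists (\matrix_(i, j) (if i == j then 1 else if i == 0 then 0 else - t)).
    by apply: mx2_unit; rewrite !mxE /= mul0r mul1r subr0 unitr1.
  by rewrite mulmx2E !mxE /= rmorph1 rmorphN mul1r /= -tE mulNr divfK // addNr.
have [g1|g1] := eqVneq (g 1 0) 0.
  by exists 1%:M; rewrite ?unitmx1 // /padic_of_int_mx map_mx1 mul1mx g1.
exists (\matrix_(i, j) (if i == j then - (i == 1)%:R * t else 1)).
  by apply: mx2_unit; rewrite !mxE /= oppr0 !mul0r mul1r add0r unitrN unitr1.
rewrite mulmx2E !mxE /= rmorph1 mulN1r rmorphN mul1r /= -tE invfM invrK.
by rewrite mulNr mulrAC mulVf // mul1r subrr.
Qed.

End KZ.

(** This and [sum_opp] are the translation and the reflection of a sum over Z/n, with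
    representatives 0, ..., n - 1. *)
Lemma sum_succ (V : nmodType) n (G : nat -> V) : G n = G 0%N ->
  \sum_(i < n) G i.+1 = \sum_(i < n) G i.
Proof.
case: n => [|n] GnE; first by rewrite !big_ord0.
by rewrite big_ord_recr [RHS]big_ord_recl /= GnE addrC; congr (_ + _).
Qed.

Lemma sum_opp (V : nmodType) n (G : nat -> V) : G n = G 0%N ->
  \sum_(i < n) G (n - i)%N = \sum_(i < n) G i.
Proof.
move=> GnE; rewrite -(sum_succ GnE) (reindex_inj rev_ord_inj) /=.
by apply: eq_bigr => i _; rewrite subKn.
Qed.

Lemma mx2_eq (R : Type) (M N : 'M[R]_2) : M 0 0 = N 0 0 -> M 0 1 = N 0 1 ->
  M 1 0 = N 1 0 -> M 1 1 = N 1 1 -> M = N.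
Proof.
have o2 (i : 'I_2) : i = 0 \/ i = 1.
  by case: i => [[|[|//]] i2]; [left|right]; apply: val_inj.
by move=> *; apply/matrixP => i j; case: (o2 i) => ->; case: (o2 j) => ->.
Qed.

Lemma subr_div_mull (F : fieldType) (q x j : F) : q != 0 ->
  j - x / q = q * (j / q - x * q ^- 2).
Proof. by move=> q0; field. Qed.

Lemma natr_digits_rev (F : fieldType) (n c j : nat) : n%:R != 0 :> F -> (j <= n)%N ->
  (n - j)%:R / n%:R - c%:R * n%:R ^- 2 = - ((c + n * j)%:R * n%:R ^- 2) + 1 :> F.
Proof. by move=> n0 jn; rewrite natrB // natrD natrM; field. Qed.

Lemma oppr_subn (R : pzRingType) (n j : nat) : n%:R = 0 :> R -> (j <= n)%N ->
  - (n - j)%:R = j%:R :> R.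
Proof. by move=> n0 jn; rewrite natrB // n0 sub0r opprK. Qed.

Lemma expV2_sub_natrS (F : fieldType) (q : F) (n : nat) :
  q ^- 2 - n.+1%:R * q ^- 2 = - (n%:R * q ^- 2).
Proof. by rewrite -natr1; ring. Qed.

Lemma natr_addX2_div (F : fieldType) (n m : nat) : n%:R != 0 :> F ->
  - ((m + n ^ 2)%:R * n%:R ^- 2) = - (m%:R * n%:R ^- 2) - 1 :> F.
Proof. by move=> n0; rewrite natrD natrX; field. Qed.

Lemma upper_entry_divl (F : fieldType) (q t x m y c : F) : q != 0 ->
  x * q = t * m -> y * q = t * c -> forall n k, m + k * c = q * n -> x + k * y = t * n.
Proof.
move=> q0 xE yE n k mE; apply: (mulIf q0).
have -> : (x + k * y) * q = t * (m + k * c) by rewrite mulrDl -mulrA yE xE; ring.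
by rewrite mE; ring.
Qed.

Lemma upper_entry_mull (F : fieldType) (q t x m y c n k : F) :
  x * q = t * m -> y * q = t * c -> x + k * y = t * n -> t * (m + k * c) = t * (q * n).
Proof.
move=> xE yE nE; have -> : t * (q * n) = (t * n) * q by ring.
rewrite -nE mulrDl -mulrA xE yE; ring.
Qed.

(** * Comparison of the two inductions *)

Section Comparison.
Variables (p : nat) (p_pr : prime p) (E : fieldExtType 'F_p).
Variables (chi : qpchar p_pr E) (r : nat).
Local Notation Zp := (padic_int p_pr).
Local Notation Qp := (padic p_pr).
Local Notation GL2 := (GL2 p_pr).
Local Notation B := (borel p_pr).
Local Notation KG := (GL2_KZ p_pr).
Local Notation KB := (borel_KZ p_pr).
Local Notation Sym := (Sym p_pr E r).
Local Notation mono := (@sym_mono p p_pr E r).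
Local Notation I := (cind_rep Sym).
Local Notation s1 := (qpchar_mul chi (qpchar_exp (omega p_pr E) r)).
Local Notation sigma := (tensor s1 chi).
Local Notation V := (cind_rep sigma).
Local Notation res x := (in_alg E (padic_res x)).
Local Notation bracI b v := (brac (sigma := Sym) (borel_gl b) v : I).
Local Notation bracV b v := (brac (sigma := sigma) b v : V).
Local Notation al := (utri_1p p_pr 1).
Local Notation al2 := (utri_1p p_pr 2).
Local Notation pQ := (p%:R : Qp).
Implicit Types (b : B).

Lemma cind_borel_eq (F1 F2 : I) : (forall b, F1 (borel_gl b) = F2 (borel_gl b)) -> F1 = F2.
Proof.
move=> F12; apply: cind_eqP => g; have [h [b [hK ->]]] := iwasawa g.
by rewrite !cind_equiv // F12.
Qed.

(** By the Iwasawa decomposition of [g^-1], every bracket can be rewritten with its group element in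
    the Borel subgroup. *)
Lemma cind_mono_ind (P : I -> Prop) : P 0 ->
    (forall a F1 F2, P F1 -> P F2 -> P (a *: F1 + F2)) ->
  (forall b i, P (bracI b (mono i))) -> forall F, P F.
Proof.
move=> P0 PD Pb; apply: (cind_ind (KZ_GL2_nbhs p_pr)) => //.
move=> g v F PF; have [h [b [hK gE]]] := iwasawa g^-1%g.
have hVK : KZset KG h^-1%g by have [_ _] := KZ_subgroup KG; apply.
have -> : g = (borel_gl b^-1 * h^-1)%g by rewrite -[g]invgK gE invgM.
rewrite brac_mulr // [kzact _ _]sym_expand brac_sum.
elim/big_rec: _ => [|i F' _ PF']; first by rewrite add0r.
by rewrite -addrA bracZ; apply: PD.
Qed.

Lemma KZ_borel_tri b : KZset KG (borel_gl b) -> exists m (M : 'M[Zp]_2),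
  [/\ M \in unitmx, M 1 0 = 0, M 0 0 \is a GRing.unit, M 1 1 \is a GRing.unit
    & gl2_mx b = p%:R ^ m *: padic_of_int_mx M].
Proof.
move=> /KZ_unimod[M Mu [m bE]].
have M10 : M 1 0 = 0.
  have := borel10 b; rewrite bE !mxE => /eqP.
  rewrite mulf_eq0 (negPf (expfz_neq0 _ (padic_p_neq0 p_pr))) /=.
  by rewrite padic_of_int_eq0 => /eqP.
have M00 : M 0 0 * (invmx M) 0 0 + M 0 1 * (invmx M) 1 0 = 1.
  by rewrite -mulmx2E mulmxV // mxE.
have unit_l (x y : Zp) : x * y = 1 -> x \is a GRing.unit.
  by move=> xy; apply/unitrP; exists y; rewrite [y * x]mulrC.
have M11u : M 1 1 \is a GRing.unit.
  apply: (unit_l _ ((invmx M) 1 1)).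
  have := congr1 (fun N : 'M_2 => N 1 1) (mulmxV Mu).
  by rewrite mulmx2E M10 mul0r add0r mxE.
have V10 : (invmx M) 1 0 = 0.
  have := congr1 (fun N : 'M_2 => N 1 0) (mulmxV Mu).
  rewrite mulmx2E M10 mul0r add0r mxE /= => /(congr1 (fun x => (M 1 1)^-1 * x)).
  by rewrite mulKr // mulr0.
exists m, M; split => //; apply: (unit_l _ ((invmx M) 0 0)).
by rewrite V10 mulr0 addr0 in M00.
Qed.

Lemma sym_coef_act b m (M : 'M[Zp]_2) (i : 'I_r.+1) s :
  M \in unitmx -> M 1 0 = 0 -> gl2_mx b = p%:R ^ m *: padic_of_int_mx M ->
  sym_coef (kzact (k := Sym) (borel_gl b) (mono i)) s =
  res (M 0 0) ^+ (r - i) * ('C(i, s)%:R * res (M 0 1) ^+ (i - s) * res (M 1 1) ^+ s).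
Proof.
move=> Mu M10 bE; rewrite /= /sym_act (unimod_part_eq Mu bE).
by rewrite sym_coef_lin_act /red_mx; [rewrite !mxE | rewrite mxE /= M10 !rmorph0 scale0r].
Qed.

(** An upper triangular matrix multiplies x by its upper left entry, and [omega] ignores the scalar
    power of p. *)
Lemma sym_act_mono0 b : KZset KG (borel_gl b) ->
  kzact (k := Sym) (borel_gl b) (mono ord0) = omega p_pr E (b 0 0) ^+ r *: mono ord0.
Proof.
move=> /KZ_borel_tri[m [M [Mu M10 M00 _ bE]]]; apply: sym_coef_eq => s _.
rewrite (sym_coef_act _ _ Mu M10 bE) sym_coefZ sym_coef_mono /= subn0 bE !mxE.
rewrite /= unit_part_eq //; congr (_ * _).
by case: s => [|s]; rewrite ?expr0 ?mulr1 // bin0n /= !mul0r.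
Qed.

Lemma chi_det_neq0 b : chi_det chi b != 0.
Proof. by rewrite qpchar_neq0 // -unitfE -unitmxE gl2_unit. Qed.

Lemma chi_detM b b' : chi_det chi (b * b')%g = chi_det chi b * chi_det chi b'.
Proof.
have det_neq0 (k : B) : \det k != 0 by rewrite -unitfE -unitmxE gl2_unit.
by rewrite /chi_det det_mulmx qpcharM.
Qed.

Lemma chi_detE b : chi_det chi b = chi (b 0 0) * chi (b 1 1).
Proof.
rewrite -qpcharM ?borel00_neq0 ?borel11_neq0 // /chi_det; congr (chi _).
by rewrite det_mx2 borel10 mulr0 subr0.
Qed.

(* By the Iwasawa decomposition an element of [I] is determined by its values on [B]. *)
Definition extends (f : V) (F : I) :=
  forall b, F (borel_gl b) = ((chi_det chi b)^-1 * f b) *: mono ord0.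

Lemma extends_linear a f g F1 F2 : extends f F1 -> extends g F2 ->
  extends (a *: f + g) (a *: F1 + F2).
Proof.
move=> fF gG b; rewrite cind_addE cind_scaleE fF gG scalerA -scalerDl.
by rewrite cind_addE cind_scaleE mulrDr [in RHS]mulrCA.
Qed.

(** On KZ, [sigma] is the product of [chi] of the determinant and of the character omega^r through
    which x^r is multiplied. *)
Lemma extends_brac b (v : E^o) :
  extends (bracV b v) (chi_det chi b *: bracI b (v *: mono ord0)).
Proof.
move=> x; rewrite cind_scaleE; have [xb|xb] := pselect (KZset KB (x * b)%g).
  have /KZ_borelE xb' := xb.
  rewrite !brac_in // kzactZ (sym_act_mono0 xb') !scalerA; congr (_ *: _).
  rewrite -[kzact _ _]/((qpchar_mul chi (qpchar_exp (omega p_pr E) r) ((x * b)%g 0 0)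
    * chi ((x * b)%g 1 1)) * v).
  have := chi_detM x b; rewrite [in LHS]chi_detE => chi_xb.
  rewrite [qpchar_mul _ _ _]/(chi _ * _) [X in _ = _^-1 * (X * _)]mulrAC chi_xb.
  by rewrite -!mulrA mulKf ?chi_det_neq0 // [_ * v]mulrC.
rewrite !brac_out ?mulr0 ?scaler0 ?scale0r // => xb'.
by apply: xb; apply/KZ_borelE; exact: xb'.
Qed.

Lemma extends_exists f : exists F, extends f F.
Proof.
move: f; apply: (cind_ind (KZ_borel_nbhs p_pr)) => [|b v f [F fF]].
  by exists 0 => b; rewrite !cind_0E mulr0 scale0r.
exists (1 *: (chi_det chi b *: bracI b (v *: mono ord0)) + F).
rewrite -[bracV b v]scale1r; apply: extends_linear fF; exact: extends_brac.
Qed.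

Lemma extends_uniq f F1 F2 : extends f F1 -> extends f F2 -> F1 = F2.
Proof. by move=> F1E F2E; apply: cind_borel_eq => b; rewrite F1E F2E. Qed.

Definition sym_extension (f : V) : I := xget 0 [set F | extends f F]%classic.

Lemma sym_extensionP f : extends f (sym_extension f).
Proof.
have [F fF] := extends_exists f; rewrite /sym_extension.
by case: xgetP => [//|/(_ F)].
Qed.

Lemma sym_extension_linear a f g :
  sym_extension (a *: f + g) = a *: sym_extension f + sym_extension g.
Proof.
apply: extends_uniq (sym_extensionP _) _.
by apply: extends_linear; exact: sym_extensionP.
Qed.

Lemma sym_extension_brac b (v : E^o) :
  sym_extension (bracV b v) = chi_det chi b *: bracI b (v *: mono ord0).
Proof. by apply: extends_uniq (sym_extensionP _) _; exact: extends_brac. Qed.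

Lemma sym_extension_act b f :
  sym_extension (ract b f) = chi_det chi b *: ract (borel_gl b) (sym_extension f).
Proof.
apply: extends_uniq (sym_extensionP _) _ => x.
rewrite cind_scaleE !cind_ractE (sym_extensionP f (x * b)%g) scalerA chi_detM; congr (_ *: _).
by rewrite invfM mulrA [_ * (_ / _)]mulrC mulrVK // unitfE chi_det_neq0.
Qed.

(** * The Hecke operator on brackets *)

Variable T : rep_hom I I.
Hypothesis hecke_T : is_hecke T.
Local Notation Phi := sym_extension.

Lemma pchar_E : p \in [pchar E].
Proof. by rewrite (fmorph_pchar (in_alg E)) pchar_Fp. Qed.

Definition shift_mx (x : Zp) : 'M[Zp]_2 :=
  \matrix_(i, j) (if i == j then 1 else if i == 0 then x else 0).

Lemma shift_mx_unit x : shift_mx x \in unitmx.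
Proof. by apply: mx2_unit; rewrite !mxE /= mulr0 subr0 mulr1 unitr1. Qed.

Definition sym_shift (x : Zp) (P : Sym) : Sym := lin_act (red_mx E (shift_mx x)) P.

Lemma sym_coef_shift x (i : 'I_r.+1) s :
  sym_coef (sym_shift x (mono i)) s = 'C(i, s)%:R * res x ^+ (i - s).
Proof.
rewrite sym_coef_lin_act /red_mx; last by rewrite !mxE /= rmorph0 scale0r.
by rewrite !mxE /= rmorph1 scale1r !expr1n mul1r mulr1.
Qed.

Lemma sym_shift0 P : sym_shift 0 P = P.
Proof.
rewrite /sym_shift (_ : red_mx E _ = 1%:M) ?lin_act1 //.
apply/matrixP => i j; rewrite !mxE /=.
by case: eqP => _; [rewrite rmorph1 scale1r | case: ifP; rewrite ?rmorph0 ?scale0r].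
Qed.

Lemma sym_shift_mono0 x : sym_shift x (mono ord0) = mono ord0.
Proof.
apply: sym_coef_eq => s _; rewrite sym_coef_shift sym_coef_mono bin0n sub0n mulr1.
by rewrite eq_sym.
Qed.

Lemma utriE a c d (a0 : a != 0) (d0 : d != 0) :
  (utri (p_pr := p_pr) c a0 d0 0 0 = a) * (utri c a0 d0 0 1 = c) * (utri c a0 d0 1 1 = d).
Proof. by rewrite !mxE. Qed.

Lemma borel_mulE b b' : ((b * b')%g 0 0 = b 0 0 * b' 0 0) *
  ((b * b')%g 0 1 = b 0 0 * b' 0 1 + b 0 1 * b' 1 1) * ((b * b')%g 1 1 = b 1 1 * b' 1 1).
Proof.
have mE i j : (b * b')%g i j = (gl2_mx b *m b') i j by [].
by rewrite !mE !mulmx2E !borel10 mulr0 mul0r addr0 add0r.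
Qed.

(** The hypotheses say that [b] is p^m b' (1 x ; 0 1); the scalar acts trivially and the unipotent
    factor moves onto [P]. *)
Lemma brac_shift b b' (m : int) x (P : Sym) : b 0 0 = p%:R ^ m * b' 0 0 ->
    b 1 1 = p%:R ^ m * b' 1 1 ->
    b 0 1 = p%:R ^ m * (b' 0 1 + b' 0 0 * padic_of_int x) ->
  bracI b P = bracI b' (sym_shift x P).
Proof.
move=> b00 b11 b01; pose k := (b'^-1 * b)%g.
have kE : gl2_mx k = p%:R ^ m *: padic_of_int_mx (shift_mx x).
  apply: (can_inj (mulKmx (gl2_unit b'))).
  rewrite -[LHS]/(gl2_mx (b' * (b'^-1 * b))%g) mulVKg.
  apply: mx2_eq; rewrite mulmx2E !mxE /= ?rmorph1 ?rmorph0 ?borel10.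
  - by rewrite b00; ring.
  - by rewrite b01; ring.
  - by ring.
  - by rewrite b11; ring.
have -> : b = (b' * k)%g by rewrite /k mulVKg.
rewrite brac_mulr; last exact: KZ_mem (shift_mx_unit x) kE.
by rewrite [kzact _ _]/(sym_act _ _) /sym_act (unimod_part_eq (shift_mx_unit x) kE).
Qed.

Definition uni (x : Qp) : B := utri x (oner_neq0 _) (oner_neq0 _).

Lemma uniE x : (uni x 0 0 = 1) * (uni x 0 1 = x) * (uni x 1 1 = 1).
Proof. by rewrite !utriE. Qed.

Lemma uni_mul x x' : (uni x * uni x')%g = uni (x + x') :> B.
Proof.
apply: val_inj; apply: val_inj; apply: mx2_eq; rewrite ?borel_mulE ?uniE ?borel10 //.
- by rewrite mul1r.
- by rewrite mul1r mulr1 addrC.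
- by rewrite mul1r.
Qed.

Lemma utri_1pE n : (utri_1p p_pr n 0 0 = 1) * (utri_1p p_pr n 0 1 = 0) *
  (utri_1p p_pr n 1 1 = pQ ^+ n).
Proof. by rewrite !utriE. Qed.

Lemma utri_p1E n : (utri_p1 p_pr n 0 0 = pQ) * (utri_p1 p_pr n 0 1 = n%:R) *
  (utri_p1 p_pr n 1 1 = 1).
Proof. by rewrite !utriE expr1. Qed.

Lemma brac_uni_mod x (n : Zp) :
  bracI (uni (x + padic_of_int n)) (mono ord0) = bracI (uni x) (mono ord0).
Proof.
rewrite (@brac_shift _ (uni x) 0 n) ?sym_shift_mono0 // !uniE expr0z !mul1r //.
Qed.

Lemma T_brac b (i : 'I_r.+1) : T (bracI b (mono i)) =
  \sum_(j < p) (- j%:R) ^+ i *: bracI (b * utri_p1 p_pr j)%g (mono ord0)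
  + (i == r :> nat)%:R *: bracI (b * al)%g (mono ord_max).
Proof.
rewrite -[X in brac X _]mulg1 -ract_brac (rhom_act T) hecke_T ractD ractZ ract_sum.
congr (_ + _ *: _); last by rewrite !ract_brac mulg1.
by apply: eq_bigr => j _; rewrite !ract_brac mulg1 bracZ.
Qed.

Definition brac_w (n : nat) : V := bracV (utri_w p_pr n) 1.
Definition brac_1p2 : V := (s1 pQ ^- 2) *: bracV al2 1.

Lemma omega_p : omega p_pr E pQ = 1.
Proof.
have pE : pQ = pQ ^ 1 * padic_of_int (1 : Zp) by rewrite rmorph1 mulr1 expr1z.
by rewrite /= {1}pE unit_part_eq ?unitr1 // rmorph1 scale1r.
Qed.

Lemma sym_extension_brac_w n : Phi (brac_w n) = bracI (uni (- (n%:R * pQ ^- 2))) (mono ord0).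
Proof.
rewrite sym_extension_brac -[utri_w _ n]/(uni (- (n%:R * pQ ^- 2))).
by rewrite chi_detE !uniE qpchar1 mulr1 !scale1r.
Qed.

Lemma sym_extension0 : Phi 0 = 0.
Proof. exact: lin_fun0 sym_extension_linear. Qed.
Lemma sym_extensionZ a f : Phi (a *: f) = a *: Phi f.
Proof. by rewrite -[a *: f]addr0 sym_extension_linear sym_extension0 addr0. Qed.
Lemma sym_extensionD f g : Phi (f + g) = Phi f + Phi g.
Proof. by rewrite -[f]scale1r sym_extension_linear !scale1r. Qed.
Lemma sym_extension_sum J (s : seq J) (Q : pred J) (F : J -> V) :
  Phi (\sum_(i <- s | Q i) F i) = \sum_(i <- s | Q i) Phi (F i).
Proof. by apply: (big_morph Phi) => [u v|]; rewrite ?sym_extensionD ?sym_extension0. Qed.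

(** Since [omega] is 1 at p, lambda is [chi p], and lambda^-2 cancels [chi] of the determinant p^2
    of [al2]. *)
Lemma sym_extension_brac_1p2 : Phi brac_1p2 = bracI al2 (mono ord0).
Proof.
rewrite /brac_1p2 sym_extensionZ sym_extension_brac scale1r scalerA.
rewrite chi_detE !utri_1pE qpchar1 mul1r.
have chi2 : chi (pQ ^+ 2) = chi pQ ^+ 2 by rewrite expr2 qpcharM ?padic_p_neq0.
have -> : s1 pQ = chi pQ by rewrite -[RHS]mulr1 -[X in _ * X](expr1n _ r) -omega_p.
rewrite chi2.
by rewrite mulVf ?scale1r // expf_neq0 // qpchar_neq0 // padic_p_neq0.
Qed.

(** The product is the scalar p times a unipotent matrix. *)
Lemma al_uni_p1 (x : Qp) j :
  bracI (al * (uni (- (x / pQ)) * utri_p1 p_pr j))%g (mono ord0) =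
  bracI (uni (j%:R / pQ - x * pQ ^- 2)) (mono ord0).
Proof.
rewrite (@brac_shift _ (uni (j%:R / pQ - x * pQ ^- 2)) 1 0) ?sym_shift0 //.
- by rewrite !borel_mulE !uniE !utri_1pE !utri_p1E expr1z !mul1r mulr1.
- by rewrite !borel_mulE !uniE !utri_1pE !utri_p1E expr1z expr1 !mulr1.
- rewrite !borel_mulE !uniE !utri_1pE !utri_p1E expr1z rmorph0 !(mul1r, mulr1, mul0r, mulr0, addr0).
  exact: subr_div_mull (padic_p_neq0 p_pr).
Qed.

Lemma al_uni_al (c : nat) P :
  bracI (al * (uni (- (c%:R / pQ)) * al))%g P = bracI al2 (sym_shift (- c%:R) P).
Proof.
rewrite (@brac_shift _ al2 0 (- c%:R)) //.
- by rewrite !borel_mulE !uniE !utri_1pE expr0z !mul1r.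
- by rewrite !borel_mulE !uniE !utri_1pE expr0z expr1 !mul1r -expr2.
- rewrite !borel_mulE !uniE !utri_1pE expr0z expr1 rmorphN rmorph_nat.
  rewrite !(mul1r, mulr1, mul0r, mulr0, addr0, add0r).
  by rewrite mulNr divfK ?padic_p_neq0.
Qed.

Lemma hecke_fiber (v : nat -> E) (i : 'I_r.+1) :
  ract (borel_gl al) (T (\sum_(c < p) v c *: bracI (uni (- (c%:R / pQ))) (mono i))) =
  Phi (bipower_sum p brac_w v i) + (i == r :> nat)%:R *:
    bracI al2 (\sum_(c < p) v c *: sym_shift (- c%:R) (mono ord_max)).
Proof.
have pQ0 := padic_p_neq0 p_pr.
rewrite rhom_sum ract_sum brac_sum scaler_sumr /bipower_sum sym_extension_sum -big_split.
apply: eq_bigr => c _; rewrite rhomZ T_brac ractZ ractD ractZ ract_sum scalerDr.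
rewrite bracZ !ract_brac; congr (_ + _); last first.
  rewrite -[(borel_gl al * _)%g]/(borel_gl (al * (uni (- (c%:R / pQ)) * al))%g).
  by rewrite al_uni_al scalerA mulrC scalerA.
rewrite sym_extension_sum scaler_sumr.
(* [F] has the same value at 0 and [p], the unipotent entry changing by the integer 1, which x^r
   does not see. Hence [j] may be replaced by [p - j], which turns [(- j) ^+ i] into [j ^+ i]. *)
pose F j : I := v c *: ((- j%:R) ^+ i *: bracI (uni (j%:R / pQ - c%:R * pQ ^- 2)) (mono ord0)).
have FpE : F p = F 0%N.
  rewrite /F (pcharf0 pchar_E); congr (_ *: (_ *: _)); rewrite divff // addrC mul0r add0r.
  by rewrite -(rmorph1 (padic_of_int (p_pr := p_pr))) brac_uni_mod.
transitivity (\sum_(j < p) F j).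
  apply: eq_bigr => j _; rewrite ractZ ract_brac /F; congr (_ *: (_ *: _)).
  exact: al_uni_p1.
rewrite -(sum_opp FpE); apply: eq_bigr => j _.
have jp : (j <= p)%N by exact: ltnW.
rewrite /F sym_extensionZ sym_extension_brac_w (oppr_subn (pcharf0 pchar_E) jp) scalerA.
congr (_ *: _); rewrite (natr_digits_rev _ pQ0 jp) -(rmorph1 (padic_of_int (p_pr := p_pr))).
exact: brac_uni_mod.
Qed.

(** * S_2 maps into the image of T *)

Hypothesis r_lt : (r < p.-1)%N.
Local Notation z := brac_w.
Local Notation y := brac_1p2.
Local Notation S := (S2 s1 chi r.+1).
Let p_gt0 : (0 < p)%N := prime_gt0 p_pr.

(** The coefficient of x^(r - s) y^s is ['C(r, s)] times the moment of index [r - s], which vanishes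
    unless [s = 0]. *)
Lemma sum_shift_moment (v : nat -> E) :
    (forall s, (s < r)%N -> moment p v s = 0) ->
  \sum_(c < p) v c *: sym_shift (- c%:R) (mono ord_max) = moment p v r *: mono ord0.
Proof.
move=> mv; apply: sym_coef_eq => s sr; rewrite sym_coef_sum sym_coefZ sym_coef_mono /=.
transitivity ('C(r, s)%:R * moment p v (r - s)).
  rewrite mulr_sumr; apply: eq_bigr => c _; rewrite sym_coefZ sym_coef_shift mulrCA.
  by rewrite rmorphN rmorph_nat /= scaleNr scaler_nat.
case: s sr => [|s] sr; first by rewrite bin0 mul1r subn0 mulr1.
by rewrite mv ?mulr0 // ltn_subrL (leq_trans _ sr).
Qed.

Lemma image_T F : T F \in image_rep T.
Proof. by apply/asboolP; exists F. Qed.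

(** Being stable under B, this preimage contains S_2 as soon as it contains the generator. *)
Definition ext_preim : {pred V} := fun f => Phi f \in image_rep T.
Lemma ext_preim_submod : submod_closed ext_preim.
Proof.
split; first by rewrite /in_mem /= /ext_preim sym_extension0 rpred0.
move=> a f g fP gP; rewrite /in_mem /= /ext_preim sym_extension_linear.
by rewrite rpredD // rpredZ.
Qed.
Lemma ext_preim_act b f : f \in ext_preim -> ract b f \in ext_preim.
Proof.
move=> fP; rewrite /in_mem /= /ext_preim sym_extension_act rpredZ //.
exact: srep_act.
Qed.
Definition ext_preim_rep : subrep V := SubRep ext_preim_submod ext_preim_act.

Lemma bipower_sum_preim v i : (i < r)%N -> bipower_sum p z v i \in ext_preim_rep.
Proof.
move=> ir; pose i' := Ordinal (ltn_trans ir (ltnSn r)).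
have := hecke_fiber v i'.
rewrite [_ == r](ltn_eqF ir) scale0r addr0 => E1.
by rewrite /in_mem /= /ext_preim -E1 srep_act // image_T.
Qed.

Lemma hecke_top v : (forall s, (s < r)%N -> moment p v s = 0) ->
  ract (borel_gl al) (T (\sum_(c < p) v c *: bracI (uni (- (c%:R / pQ))) (mono ord_max)))
  = Phi (moment p v r *: y + bipower_sum p z v r).
Proof.
move=> mv; rewrite (hecke_fiber) eqxx scale1r sum_shift_moment //.
by rewrite bracZ sym_extensionD sym_extensionZ sym_extension_brac_1p2 addrC.
Qed.

Lemma top_sum_preim v : (forall s, (s < r)%N -> moment p v s = 0) ->
  moment p v r *: y + bipower_sum p z v r \in ext_preim_rep.
Proof.
move=> mv; rewrite /in_mem /= /ext_preim -hecke_top //.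
by rewrite srep_act // image_T.
Qed.

Lemma S2E : S = span_translates (y + bin_sum p z (r.+1 * p.-1)).
Proof. by []. Qed.

Lemma S2_preim f : f \in S -> Phi f \in image_rep T.
Proof.
have := bin_sum_top_mem pchar_E r_lt bipower_sum_preim top_sum_preim.
rewrite S2E => genP /asboolP[s ->]; rewrite -[_ \in _]/(_ \in ext_preim_rep).
by rewrite rpred_sum // => a _; rewrite rpredZ // srep_act.
Qed.

Lemma S2_gen : y + bin_sum p z (r.+1 * p.-1) \in S.
Proof.
rewrite S2E; apply/asboolP; exists [:: (1, 1%g)].
by rewrite big_seq1 ract1 scale1r.
Qed.

(** The coefficient of x^r in the values of [Phi f] on B recovers [f]. Identities in [V] can thus be
    checked after applying [Phi]. *)
Lemma sym_extension_inj : injective Phi.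
Proof.
move=> f g fg; apply: cind_eqP => b.
have val (h : V) : h b = chi_det chi b * sym_coef (Phi h (borel_gl b)) 0.
  rewrite sym_extensionP sym_coefZ sym_coef_mono mulr1.
  by rewrite mulrA divff ?chi_det_neq0 // mul1r.
by rewrite val fg -val.
Qed.

Lemma chi_det_uni x : chi_det chi (uni x) = 1.
Proof. by rewrite chi_detE !uniE qpchar1 mulr1. Qed.

Lemma sym_extension_act_uni x f : Phi (ract (uni x) f) = ract (borel_gl (uni x)) (Phi f).
Proof. by rewrite sym_extension_act chi_det_uni scale1r. Qed.

(** Moving [uni (p^-2)] across [al2] turns it into [uni 1], which is integral and fixes x^r. *)
Lemma act_uni_y : ract (uni (pQ ^- 2)) y = y.
Proof.
apply: sym_extension_inj; rewrite sym_extension_act_uni sym_extension_brac_1p2 ract_brac.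
rewrite -[(borel_gl _ * borel_gl _)%g]/(borel_gl (uni (pQ ^- 2)%R * al2)%g).
rewrite (@brac_shift (uni (pQ ^- 2)%R * al2)%g al2 0 1) ?sym_shift_mono0 //.
- by rewrite !borel_mulE !uniE !utri_1pE expr0z.
- by rewrite !borel_mulE !uniE !utri_1pE expr0z.
- rewrite !borel_mulE !uniE !utri_1pE expr0z rmorph1 !(mul1r, mul0r, mulr0, add0r).
  by rewrite mulVf // expf_neq0 // padic_p_neq0.
Qed.

Lemma act_uni_z n : ract (uni (pQ ^- 2)) (z n.+1) = z n.
Proof.
apply: sym_extension_inj; rewrite sym_extension_act_uni !sym_extension_brac_w ract_brac.
by rewrite -(expV2_sub_natrS pQ n) -uni_mul.
Qed.

Lemma z_addp2 n : z (n + p ^ 2)%N = z n.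
Proof.
apply: sym_extension_inj; rewrite !sym_extension_brac_w (natr_addX2_div n (padic_p_neq0 p_pr)).
by rewrite -(rmorph1 (padic_of_int (p_pr := p_pr))) -rmorphN brac_uni_mod.
Qed.

(** The translation lowers the index of [z] by one; after a cyclic shift of the sum this is Pascal's
    rule. *)
Lemma act_bin_sum m : (m.+1 < p ^ 2)%N ->
  ract (uni (pQ ^- 2)) (bin_sum p z m.+1) = bin_sum p z m.+1 + bin_sum p z m.
Proof.
move=> mp; pose G n : V := 'C(n, m.+1)%:R *: z n.
have GpE : G (p ^ 2)%N = G 0%N.
  by rewrite /G -[(p ^ 2)%N]add0n (bin_addp2 pchar_E) // z_addp2.
rewrite {1}/bin_sum -(sum_succ GpE) ract_sum -big_split; apply: eq_bigr => n _.
by rewrite /G ractZ act_uni_z binS natrD scalerDl.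
Qed.

Lemma bin_sum_S2 m : (m < r.+1 * p.-1)%N -> bin_sum p z m \in S.
Proof.
pose l := (r.+1 * p.-1)%N; have lp : (l < p ^ 2)%N by rewrite /l; nia.
(* The fixed vector [w] is [y] when descending from the generator, and 0 afterwards; applying
   [uni (p^-2) - 1] eliminates it. *)
have step m' w : (m' < l)%N -> ract (uni (pQ ^- 2)) w = w -> 
    w + bin_sum p z m'.+1 \in S -> bin_sum p z m' \in S.
  move=> m'l w1 wS; have -> : bin_sum p z m' =
      (-1) *: (w + bin_sum p z m'.+1) + ract (uni (pQ ^- 2)) (w + bin_sum p z m'.+1).
    rewrite ractD w1 act_bin_sum ?(leq_ltn_trans m'l) //.
    by rewrite [w + (_ + _)]addrA scaleN1r addKr.
  by rewrite rpredD ?rpredZ ?srep_act.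
move=> ml; have : (m + (l - m.+1).+1 = l)%N by rewrite /l; lia.
move: (l - _)%N => k; elim: k m {ml} => [|k IHk] m mk.
  apply: (step m y); rewrite ?act_uni_y //; first by lia.
  by rewrite (_ : m.+1 = l); [exact: S2_gen|lia].
apply: (step m 0); first by lia.
  exact: lin_fun0 (@ract_linear _ _ V _).
by rewrite add0r IHk //; lia.
Qed.

(** * Coefficients of T F on the Borel subgroup *)

Lemma KZ_tri b (m : int) (a c d : Zp) : a \is a GRing.unit -> d \is a GRing.unit ->
  b 0 0 = p%:R ^ m * padic_of_int a -> b 0 1 = p%:R ^ m * padic_of_int c ->
  b 1 1 = p%:R ^ m * padic_of_int d ->
  exists2 M : 'M[Zp]_2, [/\ M \in unitmx, M 1 0 = 0, M 0 0 = a, M 0 1 = c & M 1 1 = d] &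
    gl2_mx b = p%:R ^ m *: padic_of_int_mx M.
Proof.
move=> au du b00 b01 b11.
exists (\matrix_(i, j) (if i == 0 then if j == 0 then a else c else if j == 0 then 0 else d)).
  by split; [apply: mx2_unit | | | |]; rewrite !mxE //= mulr0 subr0 unitrM au.
by apply: mx2_eq; rewrite !mxE //= rmorph0 mulr0 borel10.
Qed.

Lemma padic_res0P (x : Zp) : padic_res x = 0 -> exists n, x = p%:R * n.
Proof.
move=> xr; have [n] : exists n, x = p%:R ^+ 1 * n; last by exists n.
apply: padic_dvd; move/eqP: xr; rewrite /padic_res -(dvdn_pcharf (pchar_Fp p_pr)).
by rewrite /dvdn -[X in (_ %% X)%N]expn1 prem_mod => /eqP.
Qed.

Lemma res_natr (n : nat) : padic_res (n%:R : Zp) = n%:R.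
Proof. exact: rmorph_nat. Qed.

Lemma natr_inj_lt (c c' : nat) : (c < p)%N -> (c' < p)%N -> c%:R = c'%:R :> 'F_p -> c = c'.
Proof.
move=> cp cp' /(congr1 val) /=.
by rewrite !val_Fp_nat // !modn_small.
Qed.

(** The [p] cosets of the h u(-c/p) are therefore distinct: membership in KZ forces p to divide
    [c - c']. *)
Lemma uni_frac_KZ (c c' : nat) : (c < p)%N -> (c' < p)%N ->
  KZset KG (borel_gl (uni ((c%:R - c'%:R) / pQ))) -> c = c'.
Proof.
move=> cp cp' /KZ_borel_tri[m [M [_ _ M00 _ bE]]].
have := congr1 (fun N : 'M[Qp]_2 => N 0 0) bE; rewrite uniE mxE [padic_of_int_mx _ _ _]mxE.
have e1 : 1 = p%:R ^ 0 * padic_of_int 1 :> Qp by rewrite expr0z rmorph1 mulr1.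
rewrite {1}e1 => m0; have {}m0 := padic_factor_uniq (unitr1 _) M00 m0.
have := congr1 (fun N : 'M[Qp]_2 => N 0 1) bE; rewrite uniE mxE [padic_of_int_mx _ _ _]mxE.
rewrite -m0 expr0z mul1r => cE.
have : (c%:R - c'%:R : Zp) = M 0 1 * p%:R.
  apply: (@padic_of_int_inj p p_pr).
  by rewrite rmorphB rmorphM !rmorph_nat /= -cE divfK // padic_p_neq0.
move/(congr1 (@padic_res p p_pr)); rewrite rmorphB rmorphM !rmorph_nat pchar_Fp_0 // mulr0.
by move/eqP; rewrite subr_eq0 => /eqP; apply: natr_inj_lt.
Qed.

Lemma brac1_in b P : KZset KG (borel_gl b) ->
  bracI 1%g P (borel_gl b) = kzact (k := Sym) (borel_gl b) P.
Proof.
move=> bK; have bK1 : KZset KG (borel_gl b * borel_gl 1)%g.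
  by rewrite -[(_ * _)%g]/(borel_gl (b * 1)%g) mulg1.
by rewrite brac_in // -[(_ * _)%g]/(borel_gl (b * 1)%g) mulg1.
Qed.

Lemma brac1_out b P : ~ KZset KG (borel_gl b) -> bracI 1%g P (borel_gl b) = 0.
Proof.
move=> bK; apply: brac_out.
by rewrite -[(_ * _)%g]/(borel_gl (b * 1)%g) mulg1.
Qed.

Lemma tri_entries b (m : int) (M : 'M[Zp]_2) : gl2_mx b = p%:R ^ m *: padic_of_int_mx M ->
  forall i j, b i j = p%:R ^ m * padic_of_int (M i j).
Proof. by move=> -> i j; rewrite !mxE. Qed.

Lemma neg_ratio_Fp (a d : 'F_p) : d != 0 -> exists2 c : nat, (c < p)%N & a + c%:R * d = 0.
Proof.
move=> d0; exists (val (- a / d)); first by rewrite -[X in (_ < X)%N](Fp_cast p_pr) ltn_ord.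
by rewrite natr_Zp divfK // subrr.
Qed.

Lemma brac_coef_pos b b0 s : (0 < s)%N -> sym_coef (bracI b0 (mono ord0) (borel_gl b)) s = 0.
Proof.
move=> s0; have [K|K] := pselect (KZset KG (borel_gl (b * b0)%g)); last first.
  by rewrite brac_out ?sym_coef0.
by rewrite brac_in // (sym_act_mono0 K) sym_coefZ sym_coef_mono ltn_eqF ?mulr0.
Qed.

Lemma brac_coef_low b b0 (i : 'I_r.+1) : (i < r)%N ->
  sym_coef (bracI b0 (mono i) (borel_gl b)) r = 0.
Proof.
move=> ir; have [K|K] := pselect (KZset KG (borel_gl (b * b0)%g)); last first.
  by rewrite brac_out ?sym_coef0.
rewrite brac_in //; have [m [M [Mu M10 _ _ bE]]] := KZ_borel_tri K.
rewrite -[(borel_gl b * borel_gl b0)%g]/(borel_gl (b * b0)%g).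
by rewrite (sym_coef_act i _ Mu M10 bE) bin_small // !mul0r mulr0.
Qed.

(* The coset of [b * b0 * al] meets exactly one of the [p] cosets [uni (c / p) * al * b * b0]. *)
Lemma brac_coef_top b b0 s : (s <= r)%N ->
  sym_coef (bracI (b0 * al)%g (mono ord_max) (borel_gl b)) s =
  \sum_(c < p) sym_coef (bracI b0 (mono ord_max) (borel_gl (uni (c%:R / pQ)%R * (al * b))%g)) r
     * ('C(r, s)%:R * (- c%:R) ^+ (r - s)).
Proof.
move=> sr; have pQ0 := padic_p_neq0 p_pr.
pose x := (b * b0)%g; pose g := (x * al)%g; pose h (c : nat) := (uni (c%:R / pQ)%R * (al * x))%g.
have -> : \sum_(c < p)
     sym_coef (bracI b0 (mono ord_max) (borel_gl (uni (c%:R / pQ)%R * (al * b))%g)) r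
     * ('C(r, s)%:R * (- c%:R) ^+ (r - s)) =
   \sum_(c < p) sym_coef (bracI 1%g (mono ord_max) (borel_gl (h c))) r
     * ('C(r, s)%:R * (- c%:R) ^+ (r - s)).
  apply: eq_bigr => c _; congr (sym_coef _ _ * _).
  by rewrite -[b0]mulg1 -[in LHS](ract_brac (borel_gl b0) 1%g) cind_ractE /h /x !mulgA.
have -> : bracI (b0 * al)%g (mono ord_max) (borel_gl b) = bracI 1%g (mono ord_max) (borel_gl g).
  have -> : bracI (b0 * al)%g (mono ord_max) =
      ract (borel_gl (b0 * al)%g) (bracI 1%g (mono ord_max)).
    by rewrite ract_brac mulg1.
  by rewrite cind_ractE /g /x -mulgA.
have gE : (g 0 0 = x 0 0) * (g 0 1 = x 0 1 * pQ) * (g 1 1 = x 1 1 * pQ).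
  by rewrite !borel_mulE !utri_1pE mulr1 mulr0 add0r expr1.
have hE c : (h c 0 0 = x 0 0) * (h c 0 1 = x 0 1 + c%:R * x 1 1) * (h c 1 1 = x 1 1 * pQ).
  rewrite !borel_mulE !utri_1pE !uniE !(mul1r, mul0r, add0r, addr0) expr1.
  by rewrite mulrA divfK // [pQ * _]mulrC.
clearbody x g h; have [gK|gK] := pselect (KZset KG (borel_gl g)); last first.
  rewrite brac1_out // sym_coef0 big1 // => c _.
  have [hK|hK] := pselect (KZset KG (borel_gl (h c))); last by rewrite brac1_out // sym_coef0 mul0r.
  case: gK; have [m [M [_ _ M00 M11 /tri_entries hEm]]] := KZ_borel_tri hK.
  (* The upper right entries satisfy [g 0 1 = p * h c 0 1 - c * h c 1 1], so [h c] in KZ would put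
     [g] in KZ. *)
  have [|||N [Nu _ _ _ _] gEm] := @KZ_tri g m (M 0 0) (p%:R * M 0 1 - c%:R * M 1 1) (M 1 1) M00 M11.
  - by rewrite gE -(hE c) hEm.
  - rewrite gE rmorphB !rmorphM !rmorph_nat /= mulrBr mulrCA -hEm hE mulrCA -hEm hE.
    by rewrite mulrDr [pQ * x 0 1]mulrC [X in _ + X - _]mulrCA [pQ * _]mulrC addrK.
  - by rewrite gE -(hE c) hEm.
  exact: KZ_mem Nu gEm.
have [m [M [Mu M10 M00 M11 gEm]]] := KZ_borel_tri gK.
have gEn := tri_entries gEm.
have resM11 : padic_res (M 1 1) != 0.
  by have := rmorph_unit (@padic_res p p_pr) M11; rewrite unitfE.
(* [h c] has upper right entry p^(m - 1) (M01 + c M11), so it lies in KZ exactly for the [c] that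
   makes the bracket divisible by p. *)
have [c0 c0p c0E] := neg_ratio_Fp (padic_res (M 0 1)) resM11.
have [n nE] : exists n, M 0 1 + c0%:R * M 1 1 = p%:R * n.
  by apply: padic_res0P; rewrite rmorphD rmorphM rmorph_nat.
have nE' := congr1 (@padic_of_int p p_pr) nE.
rewrite rmorphD !rmorphM !rmorph_nat /= in nE'.
have x01 := gEn 0 1; have x11 := gEn 1 1; rewrite !gE in x01 x11.
have [|||N [Nu N10 N00 N01 N11] hEm] := @KZ_tri (h c0) m (M 0 0) n (M 1 1) M00 M11.
- by rewrite hE -gEn gE.
- by rewrite hE; exact: upper_entry_divl pQ0 x01 x11 _ _ nE'.
- by rewrite hE.
rewrite (bigD1 (Ordinal c0p)) // big1 ?Monoid.mulm1 => [|c cc0].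
  rewrite !brac1_in //; last exact: KZ_mem Nu hEm.
  rewrite (sym_coef_act ord_max s Mu M10 gEm) (sym_coef_act ord_max r Nu N10 hEm).
  rewrite -[nat_of_ord ord_max]/r -[nat_of_ord (Ordinal c0p)]/c0 N11 subnn !expr0 binn !mul1r.
  have -> : res (M 0 1) = - c0%:R * res (M 1 1).
    apply/eqP; rewrite mulNr -subr_eq0 opprK -(rmorph_nat (in_alg E)) -rmorphM -rmorphD.
    by rewrite c0E rmorph0.
  have -> : res (M 1 1) ^+ r = res (M 1 1) ^+ (r - s) * res (M 1 1) ^+ s.
    by rewrite -exprD subnK.
  by rewrite exprMn; ring.
rewrite brac1_out ?sym_coef0 ?mul0r // => hK; case/eqP: cc0; apply: val_inj.
have [m' [M' [_ _ _ M'11 /tri_entries hEm']]] := KZ_borel_tri hK.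
have h11 := hEm' 1 1; rewrite hE x11 in h11.
have mm' := padic_factor_uniq M11 M'11 h11.
have h01 := hEm' 0 1; rewrite hE -mm' in h01.
have : M 0 1 + c%:R * M 1 1 = p%:R * M' 0 1.
  apply: (@padic_of_int_inj p p_pr).
  apply: (mulfI (expfz_neq0 m pQ0)).
  rewrite rmorphD !rmorphM !rmorph_nat.
  exact: upper_entry_mull x01 x11 h01.
move/(congr1 (@padic_res p p_pr)); rewrite rmorphD !rmorphM !rmorph_nat pchar_Fp_0 // mul0r.
rewrite -c0E => /addrI/(mulIf resM11); exact: natr_inj_lt.
Qed.

(** In T [b0, e_i] the translates of x^r contribute nothing for [s > 0], which leaves the last term
    of T; this term occurs only for [i = r]. *)
Lemma hecke_coef F b s : (0 < s <= r)%N ->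
  sym_coef (T F (borel_gl b)) s =
  \sum_(c < p) sym_coef (F (borel_gl (uni (c%:R / pQ)%R * (al * b))%g)) r
     * ('C(r, s)%:R * (- c%:R) ^+ (r - s)).
Proof.
move=> /andP[s0 sr]; elim/cind_mono_ind: F b => [|a F1 F2 IH1 IH2|b0 i] b.
- rewrite (lin_fun0 (rhom_linear T)) cind_0E sym_coef0 big1 // => c _.
  by rewrite cind_0E sym_coef0 mul0r.
- rewrite (rhom_linear T) cind_addE cind_scaleE sym_coef_linear IH1 IH2.
  rewrite mulr_sumr -big_split; apply: eq_bigr => c _ /=.
  by rewrite sym_coef_linear mulrDl mulrA.
rewrite (T_brac) cind_addE cind_scaleE sym_coefD sym_coefZ cind_sumE sym_coef_sum.
rewrite big1 ?add0r => [|j _]; last first.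
  by rewrite cind_scaleE sym_coefZ brac_coef_pos // mulr0.
have [ir|] := eqVneq (i : nat) r.
  have -> : i = ord_max by apply: val_inj.
  by rewrite mul1r brac_coef_top.
move=> ir'; have ir : (i < r)%N by have := ltn_ord i; lia.
by rewrite mul0r big1 // => c _; rewrite brac_coef_low ?mul0r.
Qed.

(** * Elements of the image of T with values in the line of x^r *)

Definition ext_S2 (F : I) : Prop := exists2 f, f \in S & F = Phi f.

Lemma ext_S2_0 : ext_S2 0.
Proof. by exists 0; rewrite ?rpred0 // sym_extension0. Qed.

Lemma ext_S2_linear a F1 F2 : ext_S2 F1 -> ext_S2 F2 -> ext_S2 (a *: F1 + F2).
Proof.
move=> [f fS ->] [g gS ->]; exists (a *: f + g); last by rewrite sym_extension_linear.
by rewrite rpredD // rpredZ.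
Qed.

Lemma ext_S2D F1 F2 : ext_S2 F1 -> ext_S2 F2 -> ext_S2 (F1 + F2).
Proof. by move=> F1S F2S; rewrite -[F1]scale1r; exact: ext_S2_linear. Qed.

Lemma ext_S2_act b F : ext_S2 F -> ext_S2 (ract (borel_gl b) F).
Proof.
move=> [f fS ->]; exists ((chi_det chi b)^-1 *: ract b f).
  by rewrite rpredZ // srep_act.
by rewrite sym_extensionZ sym_extension_act scalerA mulVf ?scale1r // chi_det_neq0.
Qed.

Lemma ext_S2_actV b F : ext_S2 (ract (borel_gl b) F) -> ext_S2 F.
Proof.
move=> /(ext_S2_act b^-1%g); rewrite -ractM.
by rewrite -[(_ * _)%g]/(borel_gl (b^-1 * b)%g) mulVg ract1.
Qed.

(** After translation by [al], [hecke_fiber] gives [Phi] of a bipower sum, in S_2 for [i < r]. For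
    [i = r] the vanishing moments bring in the generator. *)
Lemma ext_S2_fiber (v : nat -> E) (i : 'I_r.+1) :
    ((i : nat) = r -> forall s, (s < r)%N -> moment p v s = 0) ->
  ext_S2 (T (\sum_(c < p) v c *: bracI (uni (- (c%:R / pQ))) (mono i))).
Proof.
move=> mv; apply: (@ext_S2_actV al).
have [ir|] := eqVneq (i : nat) r.
  have -> : i = ord_max by apply: val_inj.
  have {}mv := mv ir; rewrite (hecke_top) //.
  have [x xS xE] := bipower_sum_top pchar_E y r_lt mv bin_sum_S2.
  eexists; last by reflexivity.
  by rewrite xE rpredD // rpredZ // S2_gen.
move=> ir'; have ir : (i < r)%N by have := ltn_ord i; lia.
rewrite (hecke_fiber) ltn_eqF // scale0r addr0.
exists (bipower_sum p z v i); last by [].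
exact: (bipower_sum_mem pchar_E r_lt v bin_sum_S2 ir).
Qed.

(** The restriction of [F] to the [p] cosets that T couples together. *)
Definition fiber_part (F : I) (h : B) : I :=
  \sum_(c < p) bracI (h * uni (- (c%:R / pQ))%R)%g
    (F (borel_gl (h * uni (- (c%:R / pQ))%R)^-1%g)).

Definition hecke_pos_zero (F : I) :=
  forall b s, (0 < s <= r)%N -> sym_coef (T F (borel_gl b)) s = 0.

Lemma uni0 : uni 0 = 1%g :> B.
Proof. by apply: val_inj; apply: val_inj; apply: mx2_eq; rewrite !mxE. Qed.

Lemma uniV x : (uni x)^-1%g = uni (- x) :> B.
Proof. by apply: (mulgI (uni x)); rewrite mulgV uni_mul subrr uni0. Qed.

Lemma al_cancel h (c : nat) : (uni (c%:R / pQ)%R * (al * (al^-1 * h^-1)))%g =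
  (h * uni (- (c%:R / pQ))%R)^-1%g :> B.
Proof. by rewrite mulVKg invgM uniV opprK. Qed.

Lemma bin_r_neq0 s : (s <= r)%N -> 'C(r, s)%:R != 0 :> E.
Proof.
move=> sr; have rp : (r < p)%N by lia.
have := fact_neq0 pchar_E rp; rewrite -(bin_fact sr) natrM mulf_eq0 negb_or.
by case/andP.
Qed.

Lemma ext_S2_fiber_part F h : hecke_pos_zero F -> ext_S2 (T (fiber_part F h)).
Proof.
move=> F0; pose v (i : 'I_r.+1) (c : nat) :=
  sym_coef (F (borel_gl (h * uni (- (c%:R / pQ))%R)^-1%g)) i.
have -> : fiber_part F h = \sum_(i < r.+1) ract (borel_gl h)
    (\sum_(c < p) v i c *: bracI (uni (- (c%:R / pQ))) (mono i)).
  under [RHS]eq_bigr do rewrite ract_sum.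
  rewrite exchange_big; apply: eq_bigr => c _.
  rewrite [F _]sym_expand brac_sum; apply: eq_bigr => i _.
  by rewrite bracZ ractZ ract_brac.
rewrite rhom_sum; elim/big_rec: _ => [|i F' _ F'S]; first exact: ext_S2_0.
apply: ext_S2D => //; rewrite (rhom_act T); apply/ext_S2_act/ext_S2_fiber => ir s sr.
have rs : (0 < r - s <= r)%N by rewrite subn_gt0 sr leq_subr.
(* At this point [hecke_coef] samples exactly the fiber of [h], and its coefficient of index [r - s]
   is a nonzero multiple of the moment of index [s]. *)
have := F0 (al^-1 * h^-1)%g _ rs; rewrite hecke_coef //.
under eq_bigr do rewrite al_cancel subKn ?(ltnW sr) // mulrCA.
rewrite -mulr_sumr => /eqP; rewrite mulf_eq0 (negPf (bin_r_neq0 (leq_subr _ _))) /=.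
by move=> /eqP <-; apply: eq_bigr => c _; rewrite /v ir.
Qed.

Local Notation uc c := (uni (- (c%:R / pQ))%R : B).

Lemma fiber_quo h (c c' : nat) x :
  (x * (h * uc c'))%g = ((x * (h * uc c)) * uni ((c%:R - c'%:R) / pQ)%R)%g :> B.
Proof.
rewrite -!mulgA; congr (_ * (_ * _))%g; rewrite uni_mul; congr (uni _).
by rewrite mulrBl addrA addNr add0r.
Qed.

Lemma KZ_mull (g h : GL2) : KZset KG g -> (KZset KG (g * h)%g <-> KZset KG h).
Proof.
have [_ KM KV] := KZ_subgroup KG; move=> gK; split=> [ghK|]; last exact: KM.
by rewrite -(mulKg g h); apply: KM => //; exact: KV.
Qed.

Lemma fiber_part_in (F : I) h (c : 'I_p) x : KZset KG (borel_gl (x * (h * uc c))%g) ->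
  fiber_part F h (borel_gl x) = F (borel_gl x).
Proof.
move=> xK; rewrite /fiber_part cind_sumE (bigD1 c) // big1 => [|c' cc'].
  rewrite Monoid.mulm1 brac_in // -cind_equiv //; congr (F _).
  rewrite -[LHS]/(borel_gl ((x * (h * uc c)) * (h * uc c)^-1)%g).
  by rewrite mulgK.
rewrite brac_out //.
rewrite -[(_ * _)%g]/(borel_gl (x * (h * uc c'))%g) (fiber_quo h c c').
move=> /(KZ_mull _ xK) /uni_frac_KZ cE; case/eqP: cc'.
by apply/val_inj/esym/cE.
Qed.

Lemma fiber_part_out (F : I) h x :
  (forall c : 'I_p, ~ KZset KG (borel_gl (x * (h * uc c))%g)) ->
  fiber_part F h (borel_gl x) = 0.
Proof.
by move=> xK; rewrite /fiber_part cind_sumE big1 // => c _; rewrite brac_out //; exact: xK.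
Qed.

Lemma support_fibers (F : I) : exists L : seq B, forall x, F (borel_gl x) <> 0 ->
  exists2 h, h \in L & exists c : 'I_p, KZset KG (borel_gl (x * (h * uc c))%g).
Proof.
elim/cind_mono_ind: F => [|a F1 F2 [L1 IH1] [L2 IH2]|b i].
- by exists [::].
- exists (L1 ++ L2) => x; rewrite cind_addE cind_scaleE => Fx.
  have [F1x|/IH1[h hL ?]] := pselect (F1 (borel_gl x) = 0); last first.
    by exists h; rewrite // mem_cat hL.
  have /IH2[h hL ?] : F2 (borel_gl x) <> 0.
    by move=> F2x; apply: Fx; rewrite F1x F2x scaler0 addr0.
  by exists h; rewrite // mem_cat hL orbT.
exists [:: b] => x bx; exists b; first by rewrite inE.
exists (Ordinal p_gt0); rewrite mul0r oppr0 uni0 mulg1.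
by apply: contrapT => xb; apply: bx; rewrite brac_out.
Qed.

Lemma ext_S2_values (F : I) b s : ext_S2 F -> (0 < s)%N -> sym_coef (F (borel_gl b)) s = 0.
Proof.
move=> [f _ ->] s0; rewrite (sym_extensionP f) sym_coefZ sym_coef_mono.
by rewrite ltn_eqF ?mulr0.
Qed.

(** Induction on the fibers covering the support. T of one fiber part lies in the image of S_2,
    hence takes values in the line of x^r, so the remainder satisfies the same hypothesis. *)
Lemma hecke_ext_S2 F : hecke_pos_zero F -> ext_S2 (T F).
Proof.
have [L] := support_fibers F; elim: L F => [|h L IHL] F FL F0.
  have -> : F = 0.
    by apply: cind_borel_eq => b; apply: contrapT => /FL[].
  by rewrite (lin_fun0 (rhom_linear T)); exact: ext_S2_0.
have FhS : ext_S2 (T (fiber_part F h)) by exact: ext_S2_fiber_part.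
pose F' := (-1) *: fiber_part F h + F.
have FE : F = fiber_part F h + F' by rewrite /F' scaleN1r addNKr.
have TFE : T F = T (fiber_part F h) + T F'.
  by rewrite {1}FE -[fiber_part F h]scale1r (rhom_linear T) !scale1r.
rewrite TFE; apply: ext_S2D => //; apply: IHL => [x F'x|b s sr].
  have nh c : ~ KZset KG (borel_gl (x * (h * uc (c : 'I_p)))%g).
    move=> xK; apply: F'x; rewrite cind_addE cind_scaleE (fiber_part_in _ xK).
    by rewrite scaleN1r addNr.
  have /FL[h' h'L [c xK]] : F (borel_gl x) <> 0.
    move=> Fx; apply: F'x; rewrite cind_addE cind_scaleE fiber_part_out //.
    by rewrite Fx scaler0 addr0.
  move: h'L; rewrite inE => /predU1P[hh|h'L]; last by exists h' => //; exists c.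
  by case: (nh c); rewrite -hh.
have s0 : (0 < s)%N by case/andP: sr.
have := F0 b s sr; rewrite TFE cind_addE sym_coefD (ext_S2_values _ FhS s0).
by rewrite add0r.
Qed.

Lemma preim_S2 f : Phi f \in image_rep T -> f \in S.
Proof.
move=> /asboolP[F fF]; have [b s sr|g gS fg] := @hecke_ext_S2 F.
  rewrite -fF (sym_extensionP f) sym_coefZ sym_coef_mono ltn_eqF ?mulr0 //.
  by case/andP: sr.
by rewrite (_ : f = g) //; apply: sym_extension_inj; rewrite fF.
Qed.

(** * Surjectivity modulo the image of T *)

Definition covered (F : I) := exists f, F - Phi f \in image_rep T.

Lemma covered0 : covered 0.
Proof. by exists 0; rewrite sym_extension0 subr0 rpred0. Qed.

Lemma covered_linear a F1 F2 : covered F1 -> covered F2 -> covered (a *: F1 + F2).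
Proof.
move=> [f fP] [g gP]; exists (a *: f + g).
have -> : a *: F1 + F2 - Phi (a *: f + g) = a *: (F1 - Phi f) + (F2 - Phi g).
  by rewrite sym_extension_linear scalerBr opprD addrACA.
by rewrite rpredD // rpredZ.
Qed.

Lemma covered_mono0 b : covered (bracI b (mono ord0)).
Proof.
exists ((chi_det chi b)^-1 *: bracV b 1); rewrite sym_extensionZ sym_extension_brac scale1r.
by rewrite scalerA mulVf ?chi_det_neq0 // scale1r subrr rpred0.
Qed.

Lemma covered_sum J (s : seq J) (Q : pred J) (a : J -> E) (F : J -> I) :
  (forall j, covered (F j)) -> covered (\sum_(j <- s | Q j) a j *: F j).
Proof.
move=> FC; elim/big_rec: _ => [|j F' _ F'C]; first exact: covered0.
exact: covered_linear.
Qed.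

(** T [b al^-1, y^r] is [b, y^r] plus brackets of multiples of x^r. *)
Lemma covered_mono_max b : covered (bracI b (mono ord_max)).
Proof.
have := T_brac (b * al^-1)%g ord_max.
rewrite eqxx scale1r mulgVK => /esym/eqP; rewrite addrC eq_sym -subr_eq => /eqP bE.
rewrite -bE -scaleN1r addrC; apply: covered_linear.
  by apply: covered_sum => j; exact: covered_mono0.
by exists 0; rewrite sym_extension0 subr0 image_T.
Qed.

(* The translates [(c x + y)^r], [c <= r], of [y^r] span [Sym^r] by Vandermonde. *)
Lemma covered_mono b (i : 'I_r.+1) : covered (bracI b (mono i)).
Proof.
pose W : 'M[E]_r.+1 := Vandermonde r.+1 (\row_c (c : nat)%:R).
have Wu : W \in unitmx.
  rewrite unitmxE det_Vandermonde unitfE; apply/prodf_neq0 => j _.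
  apply/prodf_neq0 => k jk; rewrite !mxE subr_eq0.
  have rp : (r < p)%N by lia.
  rewrite -!(rmorph_nat (in_alg E)) (inj_eq (fmorph_inj _)); apply: contraTneq jk.
  move/(natr_inj_lt) => -> //; first by rewrite ltnn.
    by rewrite (leq_trans (ltn_ord k)).
  by rewrite (leq_trans (ltn_ord j)).
(* The index is reversed because c occurs to the power [r - s] in the coefficient of x^(r - s) y^s
   of (c x + y)^r. *)
pose a c := (invmx W) c (rev_ord i).
have aE (s : 'I_r.+1) : \sum_c a c * c%:R ^+ (r - s) = (s == i)%:R.
  have := congr1 (fun M : 'M_r.+1 => M (rev_ord s) (rev_ord i)) (mulmxV Wu).
  rewrite !mxE (inj_eq rev_ord_inj) => <-; apply: eq_bigr => c _.
  by rewrite /W !mxE mulrC /= subSS.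
have bE : ('C(r, i)%:R)^-1 *: (\sum_c a c *: bracI (b * uni (c : nat)%:R)%g (mono ord_max)) + 0
    = bracI b (mono i).
  rewrite addr0; under eq_bigr => c _.
    rewrite (@brac_shift (b * uni (c : nat)%:R)%g b 0 c%:R); first last.
    - by rewrite borel_mulE !uniE expr0z mul1r !mulr1 addrC rmorph_nat.
    - by rewrite borel_mulE !uniE expr0z mul1r mulr1.
    - by rewrite borel_mulE !uniE expr0z mul1r mulr1.
    rewrite -bracZ; over.
  rewrite -brac_sum -bracZ; congr (brac _ _).
  apply: sym_coef_eq => s sr; rewrite sym_coefZ sym_coef_sum sym_coef_mono.
  have {}sr : (s < r.+1)%N by [].
  transitivity (('C(r, i)%:R)^-1 * ('C(r, s)%:R * (Ordinal sr == i)%:R) : E).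
    congr (_ * _); rewrite -aE mulr_sumr; apply: eq_bigr => c _.
    rewrite sym_coefZ sym_coef_shift mulrCA; congr (_ * (_ * _ ^+ _)).
    by rewrite res_natr rmorph_nat.
  rewrite -val_eqE /=; have [->|si] := eqVneq s i; rewrite ?eqxx.
    by rewrite mulr1 mulVf // bin_r_neq0 // -ltnS.
  by rewrite !mulr0.
rewrite -bE; apply: covered_linear; last exact: covered0.
by apply: covered_sum => c; exact: covered_mono_max.
Qed.

Lemma sym_extension_cover F : covered F.
Proof.
elim/cind_mono_ind: F => [|a F1 F2|b i].
- exact: covered0.
- exact: covered_linear.
- exact: covered_mono.
Qed.

End Comparison.

(** * The isomorphism *)

Definition quot_pi (G : groupType) (F : fieldType) (V : rep G F) (S : subrep V) (v : V) :
  quot_space S := (\pi_(quot_space S))%qT v.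

Section QuotientMap.
Variables (G : groupType) (F : fieldType) (V : rep G F) (S : subrep V).

Lemma quot_pi_eqP (u v : V) : quot_pi S u = quot_pi S v <-> u - v \in S.
Proof. exact: quot_eqP. Qed.

Lemma quot_pi_repr (x : quot_space S) : quot_pi S (repr x) = x.
Proof. exact: reprK. Qed.

Lemma quot_pi_linear : linear (quot_pi S).
Proof.
move=> a u v; have piD (x x' : V) : quot_pi S (x + x') = quot_pi S x + quot_pi S x'.
  exact: Quotient.pi_add.
rewrite piD; congr (_ + _); apply/quot_pi_eqP.
rewrite -scalerBr; have [S0 SZ] := srep_submod S.
have uu : u - repr (quot_pi S u) \in S by apply/quot_pi_eqP; rewrite quot_pi_repr.
by have := SZ a _ 0 uu S0; rewrite addr0.
Qed.

Lemma quot_pi_act g v : quot_act g (quot_pi S v) = quot_pi S (ract g v).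
Proof. exact: quot_actE. Qed.

End QuotientMap.

Theorem theorem3p2p6 (p : nat) (p_pr : prime p) (E : fieldExtType 'F_p)
    (h : nat) (hP : (1 <= h <= p.-1)%N)
    (chi : qpchar p_pr E) (chi_smooth : smooth chi)
    (T : rep_hom (cind_rep (Sym p_pr E h.-1)) (cind_rep (Sym p_pr E h.-1)))
    (hecke_T : is_hecke T) :
  rep_iso (Pi2 (qpchar_mul chi (qpchar_exp (omega p_pr E) h.-1)) chi h)
          (res_twist_det chi (quot_rep (image_rep T))).
Proof.
case: h => [//|r] in hP T hecke_T *; have r_lt : (r < p.-1)%N by [].
rewrite -[r.+1.-1]/r in T hecke_T *.
pose Phi := @sym_extension p p_pr E chi r.
set s1 := qpchar_mul _ _; pose S := S2 s1 chi r.+1; pose S' := image_rep T.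
pose f (x : quot_space S) : quot_space S' := quot_pi S' (Phi (repr x)).
have PhiL a u v : Phi (a *: u + v) = a *: Phi u + Phi v by exact: sym_extension_linear.
have PhiB u v : Phi u - Phi v = Phi (u - v).
  by rewrite [u - v]addrC -[- v]scaleN1r PhiL scaleN1r addrC.
(* [preim_S2] is applied to a difference already known to lie in [S]? No: see the next comment. *)
have fE v : f (quot_pi S v) = quot_pi S' (Phi v).
  apply/quot_pi_eqP; rewrite PhiB; apply: (S2_preim hecke_T r_lt).
  by apply/quot_pi_eqP; rewrite quot_pi_repr.
have f_linear : linear f.
  move=> a x y; rewrite -[x]quot_pi_repr -[y]quot_pi_repr -quot_pi_linear !fE.
  by rewrite PhiL quot_pi_linear.
have f_act b x : f (quot_act b x) = chi_det chi b *: quot_act (borel_gl b) (f x).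
  rewrite -[x]quot_pi_repr quot_pi_act !fE quot_pi_act.
  have -> : Phi (ract b (repr x)) = chi_det chi b *: ract (borel_gl b) (Phi (repr x)).
    exact: sym_extension_act.
  by rewrite -[chi_det chi b *: _]addr0 quot_pi_linear (lin_fun0 (quot_pi_linear _)) addr0.
exists (@RepHom _ _ (quot_rep S) (res_twist_det chi (quot_rep S')) f f_linear f_act).
(* [g] chooses preimages under [Phi] modulo the image of T; by [preim_S2] their classes modulo S_2
   are determined, which yields the inverse of [f]. *)
have [g gP] := choice (sym_extension_cover chi hecke_T r_lt).
exists (fun x : quot_space S' => quot_pi S (g (repr x))) => /= x.
  rewrite -[RHS]quot_pi_repr; apply/quot_pi_eqP/(preim_S2 hecke_T r_lt).
  rewrite -[sym_extension _]PhiB.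
  have w1 : repr (f x) - Phi (repr x) \in S' by apply/quot_pi_eqP; rewrite quot_pi_repr.
  have w2 := gP (repr (f x)); rewrite -[sym_extension _]/(Phi _) in w2.
  have [S0 SZ] := srep_submod S'.
  have -> : Phi (g (repr (f x))) - Phi (repr x) =
      (-1) *: (repr (f x) - Phi (g (repr (f x)))) + (repr (f x) - Phi (repr x)).
    by rewrite scaleN1r opprB addrA subrK.
  exact: SZ.
pose w : cind_rep (Sym p_pr E r) := repr (x : quot_space S').
transitivity (quot_pi S' (Phi (g w))); first exact: fE.
have -> : quot_pi S' (Phi (g w)) = quot_pi S' w by apply/esym/quot_pi_eqP; exact: gP.
exact: (quot_pi_repr (x : quot_space S')).
Qed.
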